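(* Let $\hat H=\sum_{\bm R\in\Lambda}\hat H_{\bm R}$ be a free-fermion Hamiltonian, not necessarily $\mathrm{U}(1)$-symmetric, on the periodic lattice $\Lambda=(\mathbb Z/L)^d$ with $N$ fermionic modes per unit cell, with local terms of Bogoliubov–de Gennes form $\hat H_{\bm R}=\hat\Psi^\dagger h_{\bm R}\hat\Psi+C_{\bm R}$ of range $r$, where $L>2(2r+1)$. Assume that $\hat H$ is invariant under all lattice translations and that $\hat H=\sum_{\bm R}\hat H_{\bm R}$ is frustration-free. Let $H^{\mathrm{BdG}}_{\bm k}$, $\bm k\in(\mathbb R/2\pi\mathbb Z)^d$, be the $2N\times 2N$ Bloch BdG matrix of $\hat H$, with eigenvalues $E_1(\bm k)\le\dots\le E_{2N}(\bm k)$. If $E_n(\bm k_0)=0$ for some $n$ and some $\bm k_0$, then $$E_n(\bm k)=O(|\bm k-\bm k_0|^2)\qquad\text{as }\bm k\to\bm k_0 ;$$ that is, if the quasiparticle spectrum is gapless, the low-energy dispersion is quadratic or softer.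
   Context: Fermionic modes $\hat c_{\bm R\tau}$, $\bm R\in\Lambda$, $\tau=1,\dots,N$, satisfy the canonical anticommutation relations on the fermionic Fock space. $\hat{\bm c}$ is the column vector of all $\hat c_{\bm R\tau}$ and $\hat\Psi$ is the Nambu spinor, i.e. the column vector listing all $\hat c_{\bm R\tau}$ followed by all $\hat c_{\bm R\tau}^\dagger$; $\hat\Psi^\dagger$ is the row vector of the adjoints of its components. With $U_{\mathcal P}=\begin{pmatrix}0&\mathbb 1\\ \mathbb 1&0\end{pmatrix}$ exchanging the two halves, each $h_{\bm R}$ is a Hermitian matrix with $U_{\mathcal P}h_{\bm R}^\top U_{\mathcal P}^\dagger=-h_{\bm R}$, and its entries vanish unless both indices belong to unit cells within maximum-norm periodic distance $r$ (a non-negative integer) of $\bm R$; $C_{\bm R}\in\mathbb R$. Frustration-free: writing $E^{\min}_{\bm R}$ for the smallest eigenvalue of $\hat H_{\bm R}$ on Fock space, there is a nonzero vector $|\Phi\rangle$ with $\hat H_{\bm R}|\Phi\rangle=E^{\min}_{\bm R}|\Phi\rangle$ for all $\bm R$ simultaneously. Bloch BdG matrix: put $h=\sum_{\bm R}h_{\bm R}$ and index the Nambu components by $(\bm R,s)$ with $s\in\{1,\dots,2N\}$ (orbital together with particle/hole label). Translation invariance of $\hat H$ gives $h_{\bm R's,\bm R''s'}=t_{ss'}(\bm R'-\bm R'')$ with $t(\bm d)=0$ unless $\bm d$ has a (unique) representative in $\{-2r,\dots,2r\}^d$, and $(H^{\mathrm{BdG}}_{\bm k})_{ss'}=\sum_{\bm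 d\in\{-2r,\dots,2r\}^d}e^{-i\bm k\cdot\bm d}t_{ss'}(\bm d)$, regarded as a function of continuous $\bm k$. The quasiparticle excitation energies of $\hat H$ are twice the non-negative eigenvalues of the BdG matrix. *)

(* Defs.v *)
From HB Require Import structures.
From mathcomp Require Import all_boot all_order all_algebra.
From mathcomp Require Import complex.
From mathcomp Require Import all_classical all_reals all_analysis.
Set Implicit Arguments.
Unset Strict Implicit.
Unset Printing Implicit Defensive.
Import Order.TTheory GRing.Theory Num.Theory.
Import numFieldNormedType.Exports.
Local Open Scope ring_scope.
Local Open Scope complex_scope.
Local Open Scope sesquilinear_scope.

(* Vectors on the Fock space of M modes are columns indexed by the occupation
   basis {set 'I_M}, enumerated by [enum_rank]; the basis state of S is
   |S> = c_(m1)^dagger ... c_(mk)^dagger |0> for S = {m1 < ... < mk}. *)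
Definition fock_dim (M : nat) : nat := #|{: {set 'I_M}}|.

Definition occupied (M : nat) (a : 'I_(fock_dim M)) : {set 'I_M} := enum_val a.

Definition jw_sign (R : realType) (M : nat) (m : 'I_M) (T : {set 'I_M}) :
    R[i] :=
  (-1) ^+ #|[set m' in T | (m' < m)%N]|.

(* The Jordan-Wigner form of the annihilation operators:
   c_m |T> = (-1)^#{m' in T | m' < m} |T :\ m> if m is in T, and 0 otherwise. *)
Definition annih (R : realType) (M : nat) (m : 'I_M) : 'M[R[i]]_(fock_dim M) :=
  \matrix_(a, b)
    if (m \in occupied b) && (occupied a == occupied b :\ m)
    then jw_sign R m (occupied b) else 0.

Lemma jw_signD1 (R : realType) (M : nat) (m p : 'I_M) (T : {set 'I_M}) :
  m \in T -> jw_sign R p (T :\ m) = (-1) ^+ (m < p)%N * jw_sign R p T.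
Proof.
move=> mT; rewrite /jw_sign.
have -> : [set m' in T :\ m | (m' < p)%N] = [set m' in T | (m' < p)%N] :\ m.
  by apply/setP=> q; rewrite !inE andbA.
rewrite [in RHS](cardsD1 m) !inE mT /=.
by rewrite exprD mulrA -expr2 sqrr_sign mul1r.
Qed.

Lemma jw_sign_sqr (R : realType) (M : nat) (m : 'I_M) (T : {set 'I_M}) :
  jw_sign R m T * jw_sign R m T = 1.
Proof. by rewrite -expr2 sqrr_sign. Qed.

Lemma annihE (R : realType) (M : nat) (m : 'I_M) a b :
  annih R m a b = if (m \in occupied b) && (occupied a == occupied b :\ m)
                  then jw_sign R m (occupied b) else 0.
Proof. by rewrite mxE. Qed.

Lemma occupiedK (M : nat) (S : {set 'I_M}) : occupied (enum_rank S) = S.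
Proof. exact: enum_rankK. Qed.

Lemma occupied_inj (M : nat) : injective (@occupied M).
Proof. exact: enum_val_inj. Qed.

Lemma occupied_rank (M : nat) a : enum_rank (@occupied M a) = a.
Proof. exact: enum_valK. Qed.

Lemma annih_adjE (R : realType) (M : nat) (m : 'I_M) a b :
  (annih R m)^t* a b = annih R m b a.
Proof.
rewrite !mxE /=; case: ifP => _; last exact: conjC0.
by rewrite rmorphXn rmorphN rmorph1.
Qed.

Lemma annih_mull (R : realType) (M : nat) (p : 'I_M)
    (A : 'M[R[i]]_(fock_dim M)) a b :
  (A *m annih R p) a b =
  if p \in occupied b
  then A a (enum_rank (occupied b :\ p)) *
       jw_sign R p (occupied b) else 0.
Proof.
rewrite mxE; case: ifPn => pb; last first.
  by rewrite big1 // => c _; rewrite annihE (negbTE pb) mulr0.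
rewrite (bigD1 (enum_rank (occupied b :\ p))) //= big1 => [|c nc].
  by rewrite addr0 annihE pb occupiedK eqxx.
rewrite annihE pb /=; case: eqP => [E|]; last by rewrite mulr0.
by case/eqP: nc; rewrite -E occupied_rank.
Qed.

Lemma annih_adj_mull (R : realType) (M : nat) (p : 'I_M)
    (A : 'M[R[i]]_(fock_dim M)) a b :
  (A *m (annih R p)^t*) a b =
  if p \in occupied b then 0
  else A a (enum_rank (p |: occupied b)) *
       jw_sign R p (p |: occupied b).
Proof.
rewrite mxE; case: ifPn => pb.
  rewrite big1 // => c _; rewrite annih_adjE annihE.
  case: ifP => [/andP[_ /eqP E]|_]; last by rewrite mulr0.
  by rewrite E !inE eqxx in pb.
rewrite (bigD1 (enum_rank (p |: occupied b))) //= big1 => [|c nc].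
  by rewrite addr0 annih_adjE annihE !occupiedK setU11 finset.setU1K ?eqxx.
rewrite annih_adjE annihE; case: ifP => [/andP[pc /eqP E]|_]; last by rewrite mulr0.
by case/eqP: nc; rewrite E finset.setD1K ?occupied_rank.
Qed.

(* Canonical anticommutation relations. *)
Lemma annih_anticomm (R : realType) (M : nat) (m p : 'I_M) :
  annih R m *m annih R p + annih R p *m annih R m = 0.
Proof.
apply/matrixP=> a b; rewrite mxE !annih_mull !annihE !occupiedK [RHS]mxE.
move: (occupied a) (occupied b) => S T; rewrite !in_setD1.
have [<-|mp] := eqVneq m p; first by case: ifP; rewrite /= ?mul0r addr0.
rewrite /=; have [pT|pT] := boolP (p \in T); have [mT|mT] := boolP (m \in T);
  rewrite /= ?(mul0r, addr0) //.
have -> : T :\ m :\ p = T :\ p :\ m by apply/setP=> q; rewrite !inE andbCA.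
case: eqP => _; last by rewrite !mul0r addr0.
rewrite !jw_signD1 //; move: mp; rewrite -val_eqE /=.
by case: ltngtP => // _ _; rewrite /= ?expr1 ?expr0 !(mul1r, mulN1r, mulNr);
    rewrite [jw_sign R p T * _]mulrC ?subrr ?addNr.
Qed.

Lemma annih_anticomm_adj (R : realType) (M : nat) (m p : 'I_M) :
  annih R m *m (annih R p)^t* + (annih R p)^t* *m annih R m = ((m == p)%:R)%:M.
Proof.
apply/matrixP=> a b; rewrite mxE annih_mull annih_adj_mull annih_adjE !annihE.
rewrite !occupiedK [RHS]mxE -(inj_eq (@occupied_inj M)).
move: (occupied a) (occupied b) => S T; rewrite !inE.
have [<-|mp] := eqVneq m p.
  rewrite /=; have [mT|mT] := boolP (m \in T); rewrite ?(addr0, add0r) /=.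
    have -> : (m \in S) && (T :\ m == S :\ m) = (S == T).
      apply/andP/eqP => [[mS /eqP E]|->]; last by rewrite mT.
      by rewrite -(finset.setD1K mS) -E finset.setD1K.
    by case: (S =P T) => [->|_]; rewrite ?jw_sign_sqr ?mul0r ?mulr1n ?mulr0n.
  rewrite finset.setU1K //.
  by case: (S =P T) => _; rewrite ?jw_sign_sqr ?mul0r ?mulr1n ?mulr0n.
rewrite mul0rn /= (_ : (p \in S) && (T :\ m == S :\ p) =
   (p \notin T) && (S == p |: (T :\ m))); last first.
  apply/andP/andP => [[pS /eqP E]|[pT /eqP ->]].
    split; last by rewrite E finset.setD1K.
    apply/negP=> pT; have : p \in T :\ m by rewrite !inE eq_sym mp.
    by rewrite E !inE eqxx.
  by rewrite setU11 finset.setU1K // !inE (negbTE pT) andbF.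
have [pT|pT] := boolP (p \in T); have [mT|mT] := boolP (m \in T);
  rewrite /= ?(mul0r, addr0) //.
have VE : p |: T :\ m = (p |: T) :\ m.
  by apply/setP=> q; rewrite !inE; case: (eqVneq q p) => // ->; rewrite eq_sym mp.
rewrite VE; case: eqP => [SE|_]; last by rewrite !mul0r addr0.
have -> : jw_sign R m T = jw_sign R m ((p |: T) :\ p) by rewrite finset.setU1K.
rewrite SE !jw_signD1 ?setU11 ?inE ?mT ?orbT //.
move: mp; rewrite -val_eqE /=.
by case: ltngtP => // _ _; rewrite /= ?expr1 ?expr0 !(mul1r, mulN1r, mulNr, mulrN);
    rewrite [jw_sign R p _ * _]mulrC ?subrr ?addNr.
Qed.

Definition nambu (R : realType) (M : nat) (x : 'I_(M + M)) :
    'M[R[i]]_(fock_dim M) :=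
  match fintype.split x with
  | inl m => annih R m
  | inr m => (annih R m)^t*
  end.

Definition bdg_op (R : realType) (M : nat) (h : 'M[R[i]]_(M + M)) (C : R) :
    'M[R[i]]_(fock_dim M) :=
  \sum_x \sum_y h x y *: ((nambu R x)^t* *m nambu R y) + C%:C%:M.

Definition UP (R : realType) (M : nat) : 'M[R[i]]_(M + M) :=
  block_mx 0 1%:M 1%:M 0.

Definition is_bdg_matrix (R : realType) (M : nat) (h : 'M[R[i]]_(M + M)) :
    Prop :=
  h \is hermsymmx /\ UP R M *m h^T *m (UP R M)^t* = - h.

(* The lattice (Z/L)^d; the ring 'Z_L is Z/L for 1 < L only. *)
Definition cell (d L : nat) : finType := {ffun 'I_d -> 'Z_L}.

Definition add_cell (d L : nat) (x a : cell d L) : cell d L :=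
  [ffun i => x i + a i].

Definition periodic_dist (d L : nat) (x y : cell d L) : nat :=
  \max_(i < d) minn (x i - y i)%R (L - (x i - y i)%R).

Definition num_modes (d L N : nat) : nat := #|{: cell d L * 'I_N}|.

Definition mode (d L N : nat) (x : cell d L) (tau : 'I_N) :
    'I_(num_modes d L N) := enum_rank (x, tau).

(* Position in the Nambu spinor of the component s of the cell x: the first N
   values of s are the particle components, the last N the hole components. *)
Definition nambu_index (d L N : nat) (x : cell d L) (s : 'I_(N + N)) :
    'I_(num_modes d L N + num_modes d L N) :=
  match fintype.split s with
  | inl tau => lshift _ (mode x tau)
  | inr tau => rshift _ (mode x tau)
  end.

Definition has_range (R : realType) (d L N r : nat) (x : cell d L)
    (h : 'M[R[i]]_(num_modes d L N + num_modes d L N)) : Prop :=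
  forall (y z : cell d L) (s s' : 'I_(N + N)),
    ~~ ((periodic_dist y x <= r)%N && (periodic_dist z x <= r)%N) ->
    h (nambu_index y s) (nambu_index z s') = 0.

(* T is a lattice translation by a on the Fock space; this fixes T up to a
   phase. *)
Definition is_translation (R : realType) (d L N : nat) (a : cell d L)
    (T : 'M[R[i]]_(fock_dim (num_modes d L N))) : Prop :=
  T \is unitarymx /\
  forall (x : cell d L) (tau : 'I_N),
    T *m annih R (mode x tau) *m T^t* = annih R (mode (add_cell x a) tau).

Definition translation_invariant (R : realType) (d L N : nat)
    (H : 'M[R[i]]_(fock_dim (num_modes d L N))) : Prop :=
  forall a : cell d L, exists T : 'M[R[i]]_(fock_dim (num_modes d L N)),
    is_translation a T /\ T *m H *m T^t* = H.

(* The order on R[i] compares only numbers with equal imaginary parts, so the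
   eigenvalues of a Hermitian matrix are totally ordered. *)
Definition is_min_eigenvalue (R : realType) (n : nat) (A : 'M[R[i]]_n)
    (e : R[i]) : Prop :=
  eigenvalue A e /\ forall e' : R[i], eigenvalue A e' -> e <= e'.

Definition frustration_free (R : realType) (I : finType) (n : nat)
    (H : I -> 'M[R[i]]_n) : Prop :=
  exists Phi : 'cV[R[i]]_n, Phi != 0 /\
    forall x : I, exists e : R[i],
      is_min_eigenvalue (H x) e /\ H x *m Phi = e *: Phi.

(* u encodes the displacement u - (2r, ..., 2r) in {-2r, ..., 2r}^d. *)
Definition displacement (d r : nat) (u : {ffun 'I_d -> 'I_(4 * r).+1})
    (i : 'I_d) : int := (u i)%:Z - (2 * r)%:Z.

Definition cell_of_displacement (d L r : nat)
    (u : {ffun 'I_d -> 'I_(4 * r).+1}) : cell d L :=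
  [ffun i => (displacement u i)%:~R].

Definition phase (R : realType) (theta : R) : R[i] :=
  cos theta +i* sin theta.

(* The hopping t(u) is read off as the block of h from the cell 0 to the cell u;
   for translation-invariant h the choice of base cell is immaterial. *)
Definition bloch_bdg (R : realType) (d L N r : nat)
    (h : 'M[R[i]]_(num_modes d L N + num_modes d L N)) (k : 'rV[R]_d) :
    'M[R[i]]_(N + N) :=
  \matrix_(s, s')
    \sum_(u : {ffun 'I_d -> 'I_(4 * r).+1})
      phase (- \sum_i k 0 i * (displacement u i)%:~R) *
      h (nambu_index (cell_of_displacement L u) s)
        (nambu_index ([ffun=> 0] : cell d L) s').

Definition is_ordered_spectrum (R : realType) (n : nat) (A : 'M[R[i]]_n)
    (e : 'I_n -> R) : Prop :=
  {homo e : i j / (i <= j)%N >-> i <= j} /\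
  char_poly A = \prod_i ('X - ((e i)%:C)%:P).

Definition sqr_norm (R : realType) (d : nat) (v : 'rV[R]_d) : R :=
  \sum_i v 0 i ^+ 2.

(* Main.v *)
Require Import Defs.
From HB Require Import structures.
From mathcomp Require Import all_boot all_order all_algebra all_fingroup.
From mathcomp Require Import complex zify ring lra.
From mathcomp Require Import all_classical all_reals all_analysis.
Import Order.TTheory GRing.Theory Num.Theory.
Import numFieldNormedType.Exports.
Local Open Scope ring_scope.
Set Implicit Arguments.
Unset Strict Implicit.
Unset Printing Implicit Defensive.
Local Open Scope sesquilinear_scope.

(** Split each h_R = P_R - Q_R into its positive and negative spectral parts. If
    h_R v = a v with a > 0, then v^dagger Psi lowers the energy of H_R by 2 a, so it
    kills the common ground state Phi; likewise (w^dagger Psi)^dagger Phi = 0 if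
    h_R' w = b w with b < 0. Their anticommutator <v, w> then kills Phi, hence
    P_R Q_R' = 0 for all R, R'. So P = sum_R P_R and Q = sum_R Q_R are the positive
    and negative parts of h; being unique, they are translation invariant. As each
    P_R and Q_R is supported in a box and L > 4 r, the phases of the Bloch sums at
    continuous k are constant along the terms of P_R Q_R', which gives P_k Q_k = 0
    besides P_k, Q_k >= 0. Finally, on the kernel of P_k0 the nonnegative function
    <v, P_k v> of k vanishes at k0 and is thus O(|k - k0|^2); by min-max this bounds
    E_n(k) from above, and Q_k bounds -E_n(k) in the same way. *)

(** * Positive semidefinite matrices and spectral parts *)

Section Adjoint.
Variable C : numClosedFieldType.

Lemma adjmxM m n p (A : 'M[C]_(m, n)) (B : 'M[C]_(n, p)) :
  (A *m B)^t* = B^t* *m A^t*.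
Proof. by rewrite trmx_mul map_mxM. Qed.

Lemma adjmxD m n (A B : 'M[C]_(m, n)) : (A + B)^t* = A^t* + B^t*.
Proof. by rewrite linearD /= map_mxD. Qed.

Lemma adjmx0 m n : (0 : 'M[C]_(m, n))^t* = 0.
Proof. by rewrite trmx0 (map_mx0 Num.conj). Qed.

Lemma adjmx_sum m n (I : finType) (P : pred I) (F : I -> 'M[C]_(m, n)) :
  (\sum_(i | P i) F i)^t* = \sum_(i | P i) (F i)^t*.
Proof. by rewrite linear_sum /= map_mx_sum. Qed.

Lemma adjmxZ m n a (A : 'M[C]_(m, n)) : (a *: A)^t* = a^* *: A^t*.
Proof. by rewrite linearZ /= map_mxZ. Qed.

Lemma adjmx_diag n (d : 'rV[C]_n) : (diag_mx d)^t* = diag_mx (map_mx Num.conj d).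
Proof. by rewrite tr_diag_mx map_diag_mx. Qed.

Lemma adjmxE m n (A : 'M[C]_(m, n)) i j : (A^t*) i j = (A j i)^*.
Proof. by rewrite !mxE. Qed.

Lemma hermsymmP n (A : 'M[C]_n) : A \is hermsymmx -> A^t* = A.
Proof. by move/is_hermitianmxP; rewrite expr0 scale1r => <-. Qed.

Lemma hermsymmB n (A B : 'M[C]_n) :
  A \is hermsymmx -> B \is hermsymmx -> A - B \is hermsymmx.
Proof.
move=> /hermsymmP hA /hermsymmP hB; apply/is_hermitianmxP.
by rewrite expr0 scale1r linearB /= map_mxB hA hB.
Qed.

Definition qform n (A : 'M[C]_n) (v : 'cV[C]_n) : C := (v^t* *m A *m v) 0 0.

Definition sqnorm n (v : 'cV[C]_n) : C := (v^t* *m v) 0 0.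

Lemma sqnormE n (v : 'cV[C]_n) : sqnorm v = \sum_i `|v i 0| ^+ 2.
Proof. by rewrite /sqnorm mxE; apply: eq_bigr => i _; rewrite adjmxE normCKC. Qed.

Lemma sqnorm_ge0 n (v : 'cV[C]_n) : 0 <= sqnorm v.
Proof. by rewrite sqnormE sumr_ge0 // => i _; rewrite exprn_ge0. Qed.

Lemma sqnorm_eq0 n (v : 'cV[C]_n) : (sqnorm v == 0) = (v == 0).
Proof.
apply/idP/eqP => [|->]; last by rewrite sqnormE big1 // => i _; rewrite mxE normr0 expr0n.
rewrite sqnormE psumr_eq0 => [/allP v0|i _]; last by rewrite exprn_ge0.
apply/colP=> i; rewrite mxE; have := v0 i (mem_index_enum _).
by rewrite expf_eq0 normr_eq0 => /eqP.
Qed.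

Lemma sqnorm_gt0 n (v : 'cV[C]_n) : v != 0 -> 0 < sqnorm v.
Proof. by move=> v0; rewrite lt_neqAle sqnorm_ge0 eq_sym sqnorm_eq0 v0. Qed.

Lemma qformE n (A : 'M[C]_n) v :
  qform A v = \sum_i \sum_j (v i 0)^* * A i j * v j 0.
Proof.
rewrite /qform mxE exchange_big; apply: eq_bigr => j _ /=.
by rewrite mxE mulr_suml; apply: eq_bigr => i _; rewrite adjmxE.
Qed.

Lemma qformB n (A B : 'M[C]_n) v : qform (A - B) v = qform A v - qform B v.
Proof. by rewrite /qform mulmxBr mulmxBl; rewrite [LHS]mxE; congr (_ + _); rewrite [LHS]mxE. Qed.

Lemma qformZ n a (A : 'M[C]_n) v : qform (a *: A) v = a * qform A v.
Proof. by rewrite /qform -scalemxAr -scalemxAl mxE. Qed.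

Lemma qform_sum n (I : finType) (F : I -> 'M[C]_n) v :
  qform (\sum_i F i) v = \sum_i qform (F i) v.
Proof. by rewrite /qform mulmx_sumr mulmx_suml summxE. Qed.

(** Each product |v_i| |v_j| is at most the larger of |v_i|^2 and |v_j|^2, hence at most |v|^2. *)
Lemma qform_bound n (A : 'M[C]_n) v :
  `|qform A v| <= (\sum_i \sum_j `|A i j|) * sqnorm v.
Proof.
rewrite qformE mulr_suml; apply: le_trans (ler_norm_sum _ _ _) _.
apply: ler_sum => i _; rewrite mulr_suml; apply: le_trans (ler_norm_sum _ _ _) _.
apply: ler_sum => j _; rewrite !normrM norm_conjC mulrAC mulrC ler_wpM2l //.
have le1 k : `|v k 0| ^+ 2 <= sqnorm v.
  rewrite sqnormE (bigD1 k) //= lerDl sumr_ge0 // => l _; exact: exprn_ge0.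
have /orP[h|h] := real_leVge (normr_real (v i 0)) (normr_real (v j 0)).
  by apply: le_trans (le1 j); rewrite expr2 ler_wpM2r.
by apply: le_trans (le1 i); rewrite expr2 ler_wpM2l.
Qed.

Lemma unitary_adjK n (U : 'M[C]_n) : U \is unitarymx -> U^t* *m U = 1%:M.
Proof. by move=> Uu; apply: mulmx1C; apply/unitarymxP. Qed.

Lemma qform_diag n (d : 'rV[C]_n) v :
  qform (diag_mx d) v = \sum_j d 0 j * `|v j 0| ^+ 2.
Proof.
rewrite /qform -mulmxA mxE; apply: eq_bigr => j _.
by rewrite adjmxE mul_diag_mx mxE mulrCA normCKC.
Qed.

Lemma qform_conj n (A U : 'M[C]_n) v : qform (U^t* *m A *m U) v = qform A (U *m v).
Proof. by rewrite /qform adjmxM !mulmxA. Qed.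

Lemma sqnorm_unitary n (U : 'M[C]_n) v : U \is unitarymx -> sqnorm (U *m v) = sqnorm v.
Proof.
by move=> Uu; rewrite /sqnorm adjmxM mulmxA -(mulmxA _ _ U) unitary_adjK // mulmx1.
Qed.

Lemma diag_col n (U : 'M[C]_n) (d : 'rV[C]_n) j : U \is unitarymx ->
  (U^t* *m diag_mx d *m U) *m col j (U^t*) = d 0 j *: col j (U^t*).
Proof.
move=> Uu; rewrite !colE -!mulmxA [U *m (_ *m _)]mulmxA (unitarymxP Uu) mul1mx.
rewrite scalemxAr; congr (_ *m _); apply/matrixP=> i k; rewrite mul_diag_mx !mxE.
by have [->|_] := eqVneq i j; rewrite ?mulr0.
Qed.

Lemma eigenvalue_col n (A : 'M[C]_n) (v : 'cV[C]_n) a :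
  v != 0 -> A *m v = a *: v -> eigenvalue A a.
Proof.
move=> v0 Av; rewrite /eigenvalue /eigenspace kermx_eq0 row_free_unit.
apply: contra v0 => uA; rewrite -[v](mulKmx uA) mulmxBl Av mul_scalar_mx subrr.
by rewrite mulmx0.
Qed.

Lemma mxsub_mulmx n (X Y : 'M[C]_n) (f : 'I_n -> 'I_n) : bijective f ->
  mxsub f f X *m mxsub f f Y = mxsub f f (X *m Y).
Proof.
move=> fb; apply/matrixP=> i j; rewrite !mxE [RHS](reindex f); last exact/onW_bij.
by apply: eq_bigr => k _; rewrite !mxE.
Qed.

End Adjoint.

(** * Positive semidefinite matrices as Gram matrices *)

Section Psd.
Variable C : numClosedFieldType.

(** A rectangular factor is allowed, so that sums are obtained by stacking the factors. *)
Definition psd n (A : 'M[C]_n) := exists m (B : 'M[C]_(m, n)), A = B^t* *m B.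

Lemma psd_herm n (A : 'M[C]_n) : psd A -> A^t* = A.
Proof. by case=> m [B ->]; rewrite adjmxM trmxCK. Qed.

Lemma psd_ge0 n (A : 'M[C]_n) v : psd A -> 0 <= qform A v.
Proof.
by case=> m [B ->]; rewrite /qform mulmxA -mulmxA -adjmxM sqnorm_ge0.
Qed.

Lemma psd0 n : psd (0 : 'M[C]_n).
Proof. by exists n, 0; rewrite mulmx0. Qed.

Lemma psdD n (A B : 'M[C]_n) : psd A -> psd B -> psd (A + B).
Proof.
case=> m [X ->] [p [Y ->]]; exists (m + p)%N, (col_mx X Y).
by rewrite tr_col_mx map_row_mx mul_row_col.
Qed.

Lemma psd_sum n (I : finType) (F : I -> 'M[C]_n) :
  (forall i, psd (F i)) -> psd (\sum_i F i).
Proof. by move=> FP; elim/big_ind: _ => // [|A B]; [exact: psd0 | exact: psdD]. Qed.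

Lemma psd_mxsub n (X : 'M[C]_n) (f : 'I_n -> 'I_n) : psd X -> psd (mxsub f f X).
Proof.
case=> m [B ->]; exists m, (colsub f B); apply/matrixP=> i j.
by rewrite !mxE; apply: eq_bigr => k _; rewrite !mxE.
Qed.

Lemma mxtrace_adjM_ge0 m n (A : 'M[C]_(m, n)) : 0 <= \tr (A^t* *m A).
Proof.
apply: sumr_ge0 => i _; rewrite mxE sumr_ge0 // => j _.
by rewrite adjmxE -normCKC exprn_ge0.
Qed.

Lemma mxtrace_adjM_eq0 m n (A : 'M[C]_(m, n)) : \tr (A^t* *m A) = 0 -> A = 0.
Proof.
have ge0 i j : 0 <= (A^t*) i j * A j i by rewrite adjmxE -normCKC exprn_ge0.
move=> /eqP; rewrite psumr_eq0 => [/allP h|i _]; last first.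
  by rewrite mxE sumr_ge0.
apply/matrixP=> j i; rewrite mxE; move: (h i (mem_index_enum _)) => /=.
rewrite mxE psumr_eq0 // => /allP /(_ j (mem_index_enum _)) /=.
by rewrite adjmxE -normCKC expf_eq0 normr_eq0 => /eqP.
Qed.

(** With A = X^dagger X and B = Y^dagger Y, the trace is the squared Frobenius norm of Y
    X^dagger. *)
Lemma mxtrace_psdM_ge0 n (A B : 'M[C]_n) : psd A -> psd B -> 0 <= \tr (A *m B).
Proof.
case=> m [X ->] [p [Y ->]].
have -> : \tr (X^t* *m X *m (Y^t* *m Y)) = \tr ((Y *m X^t*) *m (Y *m X^t*)^t*).
  by rewrite adjmxM trmxCK !mulmxA -mxtrace_mulC !mulmxA.
by rewrite mxtrace_mulC mxtrace_adjM_ge0.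
Qed.

(* tr (P - P')^2 = tr (P - P')(Q - Q') = - tr P Q' - tr P' Q <= 0. *)
Lemma psd_decomposition_uniq n (P Q P' Q' : 'M[C]_n) :
  psd P -> psd Q -> psd P' -> psd Q' -> P *m Q = 0 -> P' *m Q' = 0 ->
  P - Q = P' - Q' -> P = P' /\ Q = Q'.
Proof.
move=> pP pQ pP' pQ' PQ PQ' E.
have E' : P - P' = Q - Q'.
  have -> : P = P' - Q' + Q by rewrite -E subrK.
  by rewrite [P' - Q']addrC -!addrA [P' + _]addrC subrK addrC.
suff /eqP : P - P' = 0.
  by move=> h; split; apply/eqP; rewrite -subr_eq0 -?E'.
apply: mxtrace_adjM_eq0; apply/eqP; rewrite eq_le mxtrace_adjM_ge0 andbT.
have -> : (P - P')^t* = P - P'.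
  by rewrite linearB /= map_mxB !psd_herm.
rewrite {2}E' mulmxBl !mulmxBr PQ PQ' sub0r subr0 linearD /= linearN /= linearN /=.
by rewrite -opprD oppr_le0 addr_ge0 // mxtrace_psdM_ge0.
Qed.

(* P P v = P (P - Q) v = e P v, so |P v|^2 = e <v, P v> <= 0. *)
Lemma psd_part_kills n (P Q : 'M[C]_n) e (v : 'cV[C]_n) : psd P -> P *m Q = 0 -> e <= 0 ->
  (P - Q) *m v = e *: v -> P *m v = 0.
Proof.
move=> pP PQ e0 /(congr1 (fun X => P *m X)).
rewrite mulmxA mulmxBr PQ subr0 -scalemxAr => h.
apply/eqP; rewrite -sqnorm_eq0 eq_le sqnorm_ge0 andbT.
rewrite /sqnorm adjmxM (psd_herm pP) -mulmxA [P *m _]mulmxA h -scalemxAr mxE mulmxA.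
by rewrite mulr_le0_ge0 // psd_ge0.
Qed.

End Psd.

(** * Positive and negative spectral parts of a Hermitian matrix *)

Section SpectralParts.
Variables (C : numClosedFieldType) (n : nat).
Implicit Types A : 'M[C]_n.

Definition pos_diag A : 'rV[C]_n :=
  \row_j (if 0 < spectral_diag A 0 j then spectral_diag A 0 j else 0).
(** The sign is reversed so that [neg_part A] is positive semidefinite and A is
    [pos_part A - neg_part A]. *)
Definition neg_diag A : 'rV[C]_n :=
  \row_j (if spectral_diag A 0 j < 0 then - spectral_diag A 0 j else 0).
Definition pos_part A := (spectralmx A)^t* *m diag_mx (pos_diag A) *m spectralmx A.
Definition neg_part A := (spectralmx A)^t* *m diag_mx (neg_diag A) *m spectralmx A.

Lemma psd_conj_diag (U : 'M[C]_n) (d : 'rV[C]_n) :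
  (forall j, 0 <= d 0 j) -> psd (U^t* *m diag_mx d *m U).
Proof.
move=> d0; exists n, (diag_mx (map_mx sqrtC d) *m U).
rewrite adjmxM adjmx_diag mulmxA -[in RHS](mulmxA (U^t*)) mulmx_diag.
congr (_ *m diag_mx _ *m _); apply/rowP=> j.
by rewrite !mxE conj_Creal ?ger0_real ?sqrtC_ge0 // -expr2 sqrtCK.
Qed.

Lemma pos_part_psd A : psd (pos_part A).
Proof. by apply: psd_conj_diag => j; rewrite mxE; case: ifP => // /ltW. Qed.

Lemma neg_part_psd A : psd (neg_part A).
Proof.
by apply: psd_conj_diag => j; rewrite mxE; case: ifP => // /ltW; rewrite oppr_ge0.
Qed.

Lemma spectral_eq A : A \is hermsymmx ->
  A = (spectralmx A)^t* *m diag_mx (spectral_diag A) *m spectralmx A.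
Proof.
move=> /hermitian_normalmx /orthomx_spectralP.
by rewrite invmx_unitary // spectral_unitarymx.
Qed.

Lemma spectral_real A j : A \is hermsymmx -> spectral_diag A 0 j \is Num.real.
Proof. by move=> /hermitian_spectral_diag_real /mxOverP. Qed.

Lemma pos_neg_part A : A \is hermsymmx -> A = pos_part A - neg_part A.
Proof.
move=> hA; rewrite {1}(spectral_eq hA) /pos_part /neg_part -mulmxBl -mulmxBr.
congr (_ *m _ *m _); rewrite -linearB /=; congr diag_mx; apply/rowP=> j.
rewrite !mxE; have := spectral_real j hA; rewrite realE => /orP[].
  rewrite le_eqVlt => /orP[/eqP <-|x0]; first by rewrite ltxx subr0.
  by rewrite x0 lt_gtF // subr0.
rewrite le_eqVlt => /orP[/eqP ->|x0]; first by rewrite ltxx subr0.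
by rewrite x0 lt_gtF // sub0r opprK.
Qed.

Lemma spectral_col A j : A \is hermsymmx ->
  A *m col j ((spectralmx A)^t*) = spectral_diag A 0 j *: col j ((spectralmx A)^t*).
Proof. by move=> hA; rewrite {1}(spectral_eq hA) diag_col // spectral_unitarymx. Qed.

(** In the two eigenbases the entries of the product are inner products of eigenvectors, with
    weights that vanish unless the eigenvalue of A is positive and that of B negative. *)
Lemma pos_neg_part_mul0 A B : A \is hermsymmx -> B \is hermsymmx ->
  (forall (v w : 'cV[C]_n) a b, A *m v = a *: v -> B *m w = b *: w -> 0 < a -> b < 0 ->
     v^t* *m w = 0) ->
  pos_part A *m neg_part B = 0.
Proof.
move=> hA hB orth; rewrite /pos_part /neg_part -!mulmxA.
rewrite [spectralmx A *m (_ *m _)]mulmxA [diag_mx (pos_diag A) *m (_ *m _)]mulmxA.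
rewrite [(diag_mx _ *m _) *m (_ *m _)]mulmxA.
suff -> : diag_mx (pos_diag A) *m (spectralmx A *m (spectralmx B)^t*) *m
   diag_mx (neg_diag B) = 0 by rewrite mul0mx mulmx0.
apply/matrixP=> i j; rewrite mul_mx_diag mxE mul_diag_mx mxE [RHS]mxE !mxE.
case: ifP => ai; last by rewrite !mul0r.
case: ifP => bj; last by rewrite mulr0.
have := orth _ _ _ _ (spectral_col i hA) (spectral_col j hB) ai bj.
move=> /matrixP/(_ 0 0); rewrite [RHS]mxE mxE => h.
rewrite (_ : \sum_k _ = 0) ?mulr0 ?mul0r // -[RHS]h.
by apply: eq_bigr => k _; rewrite !mxE conjCK.
Qed.

Lemma pos_neg_part_orth A : A \is hermsymmx -> pos_part A *m neg_part A = 0.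
Proof.
move=> hA; apply: pos_neg_part_mul0 => // v w a b Av Aw a0 b0.
have ar : a^* = a by rewrite conj_Creal // gtr0_real.
have : v^t* *m (A *m w) = (A *m v)^t* *m w by rewrite adjmxM (hermsymmP hA) mulmxA.
rewrite Av Aw adjmxZ ar -scalemxAr -scalemxAl => /eqP.
rewrite -subr_eq0 -scalerBl scaler_eq0 subr_eq0 => /orP[/eqP ba|/eqP //].
by have := lt_trans b0 a0; rewrite ba ltxx.
Qed.

(* The case e = 0 of psd_part_kills: it makes the parts of a local term local. *)
Lemma pos_part_col0 A x y : A \is hermsymmx -> (forall z, A z y = 0) -> pos_part A x y = 0.
Proof.
move=> hA A0; have := @psd_part_kills _ n (pos_part A) (neg_part A) 0 (delta_mx y 0).
rewrite -pos_neg_part // scale0r -!colE => /(_ (pos_part_psd A) (pos_neg_part_orth hA)).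
have -> : col y A = 0 by apply/colP=> z; rewrite !mxE A0.
by move=> /(_ (lexx _) erefl) /colP /(_ x); rewrite !mxE.
Qed.

Lemma neg_part_col0 A x y : A \is hermsymmx -> (forall z, A z y = 0) -> neg_part A x y = 0.
Proof.
move=> hA A0; have PQ := pos_neg_part_orth hA.
have QP : neg_part A *m pos_part A = 0.
  by rewrite -(psd_herm (neg_part_psd A)) -(psd_herm (pos_part_psd A)) -adjmxM PQ adjmx0.
have := @psd_part_kills _ n (neg_part A) (pos_part A) 0 (delta_mx y 0).
rewrite -opprB -pos_neg_part // scale0r mulNmx -!colE.
move=> /(_ (neg_part_psd A) QP).
have -> : col y A = 0 by apply/colP=> z; rewrite !mxE A0.
by rewrite oppr0 => /(_ (lexx _) erefl) /colP /(_ x); rewrite !mxE.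
Qed.

End SpectralParts.

(** * Vectors in intersections of spectral subspaces *)

Section MinMax.
Variables (C : numClosedFieldType) (n : nat).

(** The conditions are |S| + |T| < n linear equations in n unknowns. *)
Lemma exists_common_zero (U V : 'M[C]_n) (S T : {set 'I_n}) : (#|S| + #|T| < n)%N ->
  exists v : 'cV[C]_n, [/\ v != 0, forall j, j \in S -> (U *m v) j 0 = 0 &
    forall j, j \in T -> (V *m v) j 0 = 0].
Proof.
move=> ST; pose M := col_mx (rowsub (fun a : 'I_#|S| => enum_val a) U)
                            (rowsub (fun a : 'I_#|T| => enum_val a) V).
have : kermx M^T != 0.
  rewrite kermx_eq0 /row_free mxrank_tr neq_ltn (leq_ltn_trans _ ST) //.
  exact: rank_leq_row.
case/rowV0Pn=> w /sub_kermxP wM w0; exists w^T.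
have E : M *m w^T = 0 by rewrite -[M]trmxK -trmx_mul wM trmx0.
split; first by rewrite trmx_eq0.
  move=> j jS; move/matrixP/(_ (lshift _ (enum_rank_in jS j)) 0): E.
  rewrite mul_col_mx col_mxEu [RHS]mxE => E; rewrite -[RHS]E !mxE.
  by apply: eq_bigr => k _; rewrite !mxE enum_rankK_in.
move=> j jT; move/matrixP/(_ (rshift _ (enum_rank_in jT j)) 0): E.
rewrite mul_col_mx col_mxEd [RHS]mxE => E; rewrite -[RHS]E !mxE.
by apply: eq_bigr => k _; rewrite !mxE enum_rankK_in.
Qed.

Lemma qform_lower_bound (U : 'M[C]_n) (d : 'rV[C]_n) a v : U \is unitarymx ->
  (forall j, (U *m v) j 0 != 0 -> a <= d 0 j) ->
  a * sqnorm v <= qform (U^t* *m diag_mx d *m U) v.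
Proof.
move=> Uu ad; rewrite qform_conj -(sqnorm_unitary v Uu) qform_diag sqnormE mulr_sumr.
apply: ler_sum => j _; have [->|h] := eqVneq ((U *m v) j 0) 0.
  by rewrite normr0 expr0n !mulr0.
by rewrite ler_wpM2r ?exprn_ge0 // ad.
Qed.

(** The vector v combines the columns of U^dagger with coefficients (U v)_j, and P kills each column
    that occurs. *)
Lemma mulmx_span0 (U P : 'M[C]_n) (v : 'cV[C]_n) : U \is unitarymx ->
  (forall j, (U *m v) j 0 != 0 -> P *m col j (U^t*) = 0) -> P *m v = 0.
Proof.
move=> Uu h; rewrite -[v]mul1mx -(unitary_adjK Uu) -mulmxA mulmxA.
apply/colP=> i; rewrite mxE [RHS]mxE big1 // => j _.
have [->|/h] := eqVneq ((U *m v) j 0) 0; first by rewrite mulr0.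
by rewrite colE mulmxA -colE => /colP/(_ i); rewrite !mxE => ->; rewrite mul0r.
Qed.

End MinMax.

(** * Diagonalization in a prescribed order, and positivity from the quadratic form *)

Section Spectrum.
Variables (C : numClosedFieldType) (n : nat).
Implicit Types A : 'M[C]_n.

Lemma char_poly_conj A (U : 'M[C]_n) : U \is unitarymx ->
  char_poly (U^t* *m A *m U) = char_poly A.
Proof.
move=> Uu; have E : map_mx polyC (U^t*) *m map_mx polyC U = 1%:M.
  by rewrite -map_mxM unitary_adjK // map_mx1.
rewrite /char_poly /char_poly_mx !map_mxM.
have -> : 'X%:M = map_mx polyC (U^t*) *m 'X%:M *m map_mx polyC U :> 'M[{poly C}]_n.
  by rewrite mul_mx_scalar -scalemxAl E scalemx1.
rewrite -mulmxBl -mulmxBr !det_mulmx mulrAC -det_mulmx E det1 mul1r.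
by rewrite mul_mx_scalar -scalemxAl E scalemx1.
Qed.

(** The characteristic polynomial fixes the eigenvalues up to a permutation; permuting the rows of
    [spectralmx A] puts them in the order of e. *)
Lemma hermitian_diag A (e : 'I_n -> C) : A \is hermsymmx ->
  char_poly A = \prod_i ('X - (e i)%:P) ->
  exists2 U : 'M[C]_n, U \is unitarymx & A = U^t* *m diag_mx (\row_i e i) *m U.
Proof.
move=> hA; rewrite {1}(spectral_eq hA) char_poly_conj ?spectral_unitarymx //.
rewrite char_poly_trig ?diag_mx_is_trig //.
set U := spectralmx A; set D := spectral_diag A => E.
have /tuple_permP[p /val_inj pE] : perm_eq [tuple e i | i < n] [tuple D 0 i | i < n].
  apply: prod_XsubC_eq; rewrite !big_map -!enumT !big_enum /= -E.
  by apply: eq_bigr => i _; rewrite mxE eqxx.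
have eD i : e i = D 0 (p i).
  by have := congr1 (fun t => tnth t i) pE; rewrite !tnth_mktuple.
exists (rowsub p U).
  apply/unitarymxP/matrixP=> i j.
  have := unitarymxP (spectral_unitarymx A) => /matrixP/(_ (p i) (p j)).
  rewrite !mxE (inj_eq perm_inj) => <-.
  by apply: eq_bigr => k _; rewrite !mxE.
rewrite {1}(spectral_eq hA) -/U -/D; apply/matrixP=> i j.
rewrite !mxE (reindex_inj (@perm_inj _ p)); apply: eq_bigr => k _.
by rewrite !mul_mx_diag !mxE eD.
Qed.

(** Polarization: the form is real at e_i + c e_j, and taking c to be 1 and then the imaginary unit
    shows that A_ij and A_ji are conjugate. *)
Lemma hermitian_of_qform A : (forall v, 0 <= qform A v) -> A \is hermsymmx.
Proof.
move=> h; apply/is_hermitianmxP; rewrite expr0 scale1r; apply/matrixP=> i j.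
pose q (c : C) : C := qform A (delta_mx i 0 + c *: delta_mx j 0).
have del k : (delta_mx k 0 : 'cV[C]_n)^t* = delta_mx 0 k.
  by apply/matrixP=> a b; rewrite !mxE rmorph_nat andbC.
have ent a b : ((delta_mx 0 a : 'rV[C]_n) *m A *m (delta_mx b 0 : 'cV[C]_n)) 0 0 = A a b.
  by rewrite -rowE -colE !mxE.
have addE (X Y : 'M[C]_1) : (X + Y) 0 0 = X 0 0 + Y 0 0 by rewrite mxE.
have scaleE c (X : 'M[C]_1) : (c *: X) 0 0 = c * X 0 0 by rewrite mxE.
have qE c : q c = A i i + c * A i j + c^* * A j i + c^* * c * A j j.
  rewrite /q /qform adjmxD adjmxZ !del !mulmxDl !mulmxDr -!scalemxAl -!scalemxAr.
  by rewrite !(addE, scaleE) !ent; ring.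
have re c : (q c)^* = q c by apply: geC0_conj; apply: h.
have rii k : (A k k)^* = A k k.
  by apply: geC0_conj; have := h (delta_mx k 0); rewrite /qform del ent.
rewrite adjmxE.
have E c : c * A i j + c^* * A j i = c^* * (A i j)^* + c * (A j i)^*.
  have := re c; rewrite qE !rmorphD !rmorphM /= !rii !conjCK => /esym.
  by rewrite [c * c^*]mulrC => /addIr; rewrite -!addrA => /addrI.
have E1 := E 1; have Ei := E 'i.
rewrite !conjC1 !mul1r in E1; rewrite !conjCi !mulNr -!mulrBr in Ei.
have {}Ei : A i j - A j i = (A j i)^* - (A i j)^*.
  by apply: (mulfI (neq0Ci C)); rewrite Ei; ring.
have : 2 * A i j = 2 * (A j i)^*.
  have -> : 2 * A i j = (A i j + A j i) + (A i j - A j i) by ring.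
  by rewrite E1 Ei; ring.
by apply: mulfI; rewrite pnatr_eq0.
Qed.

Lemma psd_of_qform A : (forall v, 0 <= qform A v) -> psd A.
Proof.
move=> h; have hA := hermitian_of_qform h; rewrite (spectral_eq hA).
apply: psd_conj_diag => j.
have := h ((spectralmx A)^t* *m delta_mx j 0).
rewrite {1}(spectral_eq hA) qform_conj mulmxA (unitarymxP (spectral_unitarymx A)) mul1mx.
rewrite qform_diag (bigD1 j) //= big1 => [|k kj].
  by rewrite !mxE !eqxx normr1 expr1n mulr1 addr0.
by rewrite !mxE (negbTE kj) normr0 expr0n mulr0.
Qed.

(* A common nonzero vector v of the spectral subspaces lies in the kernel of P0,
   hence a |v|^2 <= <v, (P - Q) v> <= <v, P v> <= kappa |v|^2. *)
Lemma eigenvalue_comparison (P Q P0 Q0 U U0 : 'M[C]_n) (D D0 : 'rV[C]_n)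
    (S T : {set 'I_n}) (a kappa : C) :
  U \is unitarymx -> U0 \is unitarymx ->
  P - Q = U^t* *m diag_mx D *m U -> P0 - Q0 = U0^t* *m diag_mx D0 *m U0 ->
  (forall v, 0 <= qform Q v) -> psd P0 -> P0 *m Q0 = 0 ->
  (#|S| + #|T| < n)%N ->
  (forall j, j \notin S -> a <= D 0 j) -> (forall j, j \notin T -> D0 0 j <= 0) ->
  (forall v, P0 *m v = 0 -> qform P v <= kappa * sqnorm v) ->
  a <= kappa.
Proof.
move=> Uu U0u dE d0E Qp P0p PQ0 ST aD D0le Pb.
have [v [v0 vS vT]] := exists_common_zero U U0 ST.
rewrite -(ler_pM2r (sqnorm_gt0 v0)).
have kill : P0 *m v = 0.
  apply: (mulmx_span0 U0u) => j hj.
  have jT : j \notin T by apply: contraNN hj => /vT ->.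
  by apply: psd_part_kills P0p PQ0 (D0le j jT) _; rewrite d0E diag_col.
apply: le_trans (Pb v kill).
apply: le_trans (_ : qform (P - Q) v <= _); last by rewrite qformB gerBl.
rewrite dE; apply: qform_lower_bound => // j hj; apply: aD.
by apply: contraNN hj => /vS ->.
Qed.

End Spectrum.

(** * Bogoliubov-de Gennes operators on Fock space *)

Section Fock.
Variables (R : realType) (M : nat).
Local Notation C := R[i].
Local Notation F := (fock_dim M).
Local Notation psi := (@nambu R M).

(** The particle-hole partner of a Nambu index; [UP] is the permutation matrix of this
    involution. *)
Definition nambu_bar (x : 'I_(M + M)) : 'I_(M + M) :=
  match fintype.split x with inl m => rshift M m | inr m => lshift M m end.

Lemma nambu_barK : involutive nambu_bar.
Proof.
move=> x; rewrite -[x in RHS]splitK /nambu_bar; case: (fintype.split x) => m.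
  by rewrite -[rshift M m]/(unsplit (inr m)) unsplitK.
by rewrite -[lshift M m]/(unsplit (inl m)) unsplitK.
Qed.

Lemma nambu_lshift (m : 'I_M) : psi (lshift M m) = annih R m.
Proof. by rewrite /nambu -[lshift M m]/(unsplit (inl m)) unsplitK. Qed.

Lemma nambu_rshift (m : 'I_M) : psi (rshift M m) = (annih R m)^t*.
Proof. by rewrite /nambu -[rshift M m]/(unsplit (inr m)) unsplitK. Qed.

Lemma nambu_bar_lshift (m : 'I_M) : nambu_bar (lshift M m) = rshift M m.
Proof. by rewrite /nambu_bar -[lshift M m]/(unsplit (inl m)) unsplitK. Qed.

Lemma nambu_bar_rshift (m : 'I_M) : nambu_bar (rshift M m) = lshift M m.
Proof. by rewrite /nambu_bar -[rshift M m]/(unsplit (inr m)) unsplitK. Qed.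

Lemma nambu_adj x : (psi x)^t* = psi (nambu_bar x).
Proof.
case: (split_ordP x) => m ->.
  by rewrite nambu_bar_lshift nambu_lshift nambu_rshift.
by rewrite nambu_bar_rshift nambu_lshift nambu_rshift trmxCK.
Qed.

Lemma nambu_anticomm x y :
  psi x *m (psi y)^t* + (psi y)^t* *m psi x = ((x == y)%:R)%:M.
Proof.
case: (split_ordP x) => m ->; case: (split_ordP y) => p ->;
  rewrite ?nambu_lshift ?nambu_rshift ?trmxCK.
- by rewrite annih_anticomm_adj eq_shift.
- by rewrite annih_anticomm eq_shift raddf0.
- by rewrite -!adjmxM -adjmxD addrC annih_anticomm eq_shift adjmx0 raddf0.
- by rewrite addrC annih_anticomm_adj eq_shift eq_sym.
Qed.

Lemma nambu_anticomm_bar x y :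
  psi x *m psi y + psi y *m psi x = ((x == nambu_bar y)%:R)%:M.
Proof. by rewrite -nambu_anticomm nambu_adj nambu_barK. Qed.

Lemma UP_E x y : UP R M x y = (y == nambu_bar x)%:R.
Proof.
rewrite /UP; case: (split_ordP x) => m ->; case: (split_ordP y) => p ->;
  rewrite ?nambu_bar_lshift ?nambu_bar_rshift eq_shift.
- by rewrite block_mxEul mxE.
- by rewrite block_mxEur mxE eq_sym.
- by rewrite block_mxEdl mxE eq_sym.
- by rewrite block_mxEdr mxE.
Qed.

Lemma bdg_matrix_bar (h : 'M[C]_(M + M)) x y : is_bdg_matrix h ->
  h (nambu_bar y) (nambu_bar x) = - h x y.
Proof.
case=> _ /matrixP/(_ x y); rewrite [RHS]mxE => <-.
rewrite mxE (bigD1 (nambu_bar y)) //= big1 => [|z zy].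
  rewrite adjmxE UP_E eqxx rmorph1 mulr1 addr0.
  rewrite mxE (bigD1 (nambu_bar x)) //= big1 => [|w wx].
    by rewrite UP_E eqxx mul1r addr0 mxE.
  by rewrite UP_E (negbTE wx) mul0r.
by rewrite adjmxE UP_E (negbTE zy) rmorph0 mulr0.
Qed.

Lemma bdg_matrix_sum (I : finType) (h : I -> 'M[C]_(M + M)) :
  (forall i, is_bdg_matrix (h i)) -> is_bdg_matrix (\sum_i h i).
Proof.
move=> hh; split.
  apply/is_hermitianmxP; rewrite expr0 scale1r adjmx_sum.
  by apply: eq_bigr => i _; rewrite hermsymmP //; case: (hh i).
rewrite linear_sum mulmx_sumr mulmx_suml -sumrN.
by apply: eq_bigr => i _; case: (hh i).
Qed.

Lemma bdg_op_sum (I : finType) (h : I -> 'M[C]_(M + M)) (c : I -> R) :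
  \sum_i bdg_op (h i) (c i) = bdg_op (\sum_i h i) (\sum_i c i).
Proof.
rewrite /bdg_op big_split /=; congr (_ + _); last by rewrite rmorph_sum raddf_sum.
rewrite exchange_big; apply: eq_bigr => x _ /=; rewrite exchange_big.
by apply: eq_bigr => y _ /=; rewrite summxE scaler_suml.
Qed.

(** Carrying psi_z to the right past psi_x^dagger and then past psi_y leaves two anticommutators,
    each a scalar. *)
Lemma comm_quadratic x y z :
  psi z *m ((psi x)^t* *m psi y) - ((psi x)^t* *m psi y) *m psi z =
  (z == x)%:R *: psi y - (z == nambu_bar y)%:R *: (psi x)^t*.
Proof.
have -> : psi z *m ((psi x)^t* *m psi y) =
    (z == x)%:R *: psi y - (psi x)^t* *m (psi z *m psi y).
  by rewrite mulmxA -[psi z *m _](addrK ((psi x)^t* *m psi z)) nambu_anticomm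
    mulmxBl mul_scalar_mx -mulmxA.
rewrite -mulmxA -addrA -opprD -mulmxDr nambu_anticomm_bar.
by rewrite mul_mx_scalar.
Qed.

(** Particle-hole symmetry makes the two terms of [comm_quadratic] contribute equally; hence the
    factor 2. *)
Lemma comm_bdg_op (h : 'M[C]_(M + M)) c z : is_bdg_matrix h ->
  psi z *m bdg_op h c - bdg_op h c *m psi z = 2 *: \sum_y h z y *: psi y.
Proof.
move=> hB; rewrite /bdg_op mulmxDr mulmxDl opprD addrACA.
rewrite mul_mx_scalar mul_scalar_mx subrr addr0.
rewrite mulmx_sumr mulmx_suml -sumrB.
under eq_bigr => x _ do rewrite mulmx_sumr mulmx_suml -sumrB.
under eq_bigr => x _.
  under eq_bigr => y _ do rewrite -scalemxAr -scalemxAl -scalerBr comm_quadratic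
    scalerBr !scalerA.
  rewrite sumrB.
  over.
rewrite sumrB /=.
have -> : \sum_x \sum_y (h x y * (z == x)%:R) *: psi y = \sum_y h z y *: psi y.
  rewrite (bigD1 z) //= [X in _ + X]big1 => [|x xz].
    by rewrite addr0; apply: eq_bigr => y _; rewrite eqxx mulr1.
  by rewrite big1 // => y _; rewrite eq_sym (negbTE xz) mulr0 scale0r.
have -> : \sum_x \sum_y (h x y * (z == nambu_bar y)%:R) *: (psi x)^t* =
    - \sum_y h z y *: psi y.
  rewrite exchange_big (bigD1 (nambu_bar z)) //= [X in _ + X]big1 => [|y yz].
    rewrite addr0 -sumrN (reindex_inj (inv_inj nambu_barK)).
    apply: eq_bigr => x _ /=.
    rewrite nambu_barK eqxx mulr1 nambu_adj nambu_barK -scaleNr.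
    by rewrite -[in LHS](nambu_barK z) nambu_barK bdg_matrix_bar.
  rewrite big1 // => x _; case: eqP => [zy|]; last by rewrite mulr0 scale0r.
  by rewrite zy nambu_barK eqxx in yz.
by rewrite opprK scaler_nat mulr2n.
Qed.

(** The Fock space is nonzero even for M = 0: the vacuum, indexed by the empty set, always
    exists. *)
Lemma fock_scalar_eq0 (a : C) : a%:M = 0 :> 'M[C]_F -> a = 0.
Proof.
move=> /matrixP /(_ (enum_rank (finset.set0 : {set 'I_M})) (enum_rank (finset.set0 : {set 'I_M}))).
by rewrite !mxE eqxx mulr1n.
Qed.

(** The anticommutator with psi_y^dagger extracts the coefficient a_y as a scalar matrix. *)
Lemma nambu_free (a : 'I_(M + M) -> C) : \sum_y a y *: psi y = 0 -> forall y, a y = 0.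
Proof.
move=> h y; apply: fock_scalar_eq0.
have : (\sum_y a y *: psi y) *m (psi y)^t* + (psi y)^t* *m (\sum_y a y *: psi y) = 0.
  by rewrite h mul0mx mulmx0 addr0.
rewrite mulmx_suml mulmx_sumr -big_split (bigD1 y) //= big1 => [|x xy].
  by rewrite -scalemxAr -scalemxAl -scalerDr nambu_anticomm scale_scalar_mx eqxx mulr1 addr0.
by rewrite -scalemxAr -scalemxAl -scalerDr nambu_anticomm scale_scalar_mx (negbTE xy) mulr0 raddf0.
Qed.

(** The operator v^dagger Psi; the conjugated coefficients make its anticommutator with an adjoint
    the inner product <v, w>. *)
Definition quasi_op (v : 'cV[C]_(M + M)) : 'M[C]_F := \sum_x (v x 0)^* *: psi x.

Lemma quasi_op_anticomm v w :
  quasi_op v *m (quasi_op w)^t* + (quasi_op w)^t* *m quasi_op v = ((v^t* *m w) 0 0)%:M.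
Proof.
rewrite /quasi_op adjmx_sum !mulmx_suml.
under eq_bigr => x _ do rewrite mulmx_sumr.
under [X in _ + X]eq_bigr => x _ do rewrite mulmx_sumr.
rewrite [X in _ + X]exchange_big -big_split /= mxE raddf_sum; apply: eq_bigr => x _ /=.
rewrite -big_split (bigD1 x) //= big1 => [|y yx];
  rewrite !adjmxZ conjCK -!scalemxAr -!scalemxAl !scalerA.
  rewrite [(v x 0)^* * _]mulrC -scalerDr nambu_anticomm scale_scalar_mx eqxx mulr1 addr0.
  by rewrite adjmxE mulrC.
by rewrite [(v x 0)^* * _]mulrC -scalerDr nambu_anticomm
  scale_scalar_mx eq_sym (negbTE yx) mulr0 raddf0.
Qed.

(** An eigenvector of h yields a ladder operator, since v^dagger h = a v^dagger for Hermitian h and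
    real a. *)
Lemma comm_quasi_op (h : 'M[C]_(M + M)) c v (a : C) : is_bdg_matrix h -> a \is Num.real ->
  h *m v = a *: v ->
  quasi_op v *m bdg_op h c - bdg_op h c *m quasi_op v = (2 * a) *: quasi_op v.
Proof.
move=> hB ar hv; rewrite /quasi_op mulmx_suml mulmx_sumr -sumrB.
under eq_bigr => x _ do
  rewrite -scalemxAr -scalemxAl -scalerBr comm_bdg_op // scalerA mulrC -scalerA scaler_sumr.
rewrite -scaler_sumr exchange_big /= -scalerA; congr (_ *: _).
rewrite scaler_sumr; apply: eq_bigr => y _; rewrite scalerA.
under eq_bigr => x _ do rewrite scalerA.
rewrite -scaler_suml; congr (_ *: _).
have := congr1 (fun X => (X^t*) 0 y) hv; rewrite adjmxM adjmxZ (hermsymmP hB.1) (conj_Creal ar).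
rewrite [RHS]mxE adjmxE => <-; rewrite mxE; apply: eq_bigr => x _.
by rewrite adjmxE.
Qed.

(** The antiunitary particle-hole conjugation; it writes the adjoint of a [quasi_op] as another
    [quasi_op]. *)
Definition bar_conj (v : 'cV[C]_(M + M)) : 'cV[C]_(M + M) :=
  \col_x (v (nambu_bar x) 0)^*.

Lemma quasi_op_adj v : (quasi_op v)^t* = quasi_op (bar_conj v).
Proof.
rewrite /quasi_op adjmx_sum (reindex_inj (inv_inj nambu_barK)); apply: eq_bigr => x _.
by rewrite adjmxZ conjCK nambu_adj nambu_barK mxE conjCK.
Qed.

(** For Hermitian h, particle-hole symmetry says that h anticommutes with the antiunitary
    [bar_conj], so real eigenvalues change sign. *)
Lemma bar_conj_eigen (h : 'M[C]_(M + M)) v (a : C) : is_bdg_matrix h -> a \is Num.real ->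
  h *m v = a *: v -> h *m bar_conj v = (- a) *: bar_conj v.
Proof.
move=> hB ar hv; apply/colP=> x; rewrite [RHS]mxE [bar_conj v x 0]mxE.
have -> : - a * (v (nambu_bar x) 0)^* = - ((h *m v) (nambu_bar x) 0)^*.
  by rewrite hv mxE rmorphM /= (conj_Creal ar) mulNr.
rewrite !mxE rmorph_sum -sumrN (reindex_inj (inv_inj nambu_barK)); apply: eq_bigr => y _.
rewrite mxE nambu_barK rmorphM /= -mulNr; congr (_ * _).
have := bdg_matrix_bar x (nambu_bar y) hB; rewrite nambu_barK => E.
by rewrite -adjmxE (hermsymmP hB.1) E opprK.
Qed.

(* quasi_op v lowers the energy by 2 a, so it kills a ground state. *)
Lemma quasi_op_ground_state (h : 'M[C]_(M + M)) c v (a e : C) (Phi : 'cV[C]_F) :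
  is_bdg_matrix h -> 0 < a ->
  h *m v = a *: v -> is_min_eigenvalue (bdg_op h c) e ->
  bdg_op h c *m Phi = e *: Phi -> quasi_op v *m Phi = 0.
Proof.
move=> hB a0 hv [_ emin] hPhi; apply/eqP/negP=> /negP ne.
have hcomm := comm_quasi_op c hB (gtr0_real a0) hv.
(* If the image of Phi were nonzero, it would be an eigenvector below the least eigenvalue e. *)
suff /emin : eigenvalue (bdg_op h c) (e - 2 * a).
  by rewrite lerDl oppr_ge0 lt_geF // mulr_gt0.
apply: eigenvalue_col ne _; rewrite mulmxA.
have -> : bdg_op h c *m quasi_op v = quasi_op v *m bdg_op h c - (2 * a) *: quasi_op v.
  by rewrite -hcomm opprB addrC subrK.
by rewrite mulmxBl -mulmxA hPhi -scalemxAr -scalemxAl scalerBl.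
Qed.

(** Both [quasi_op v] and the adjoint of [quasi_op w] kill the common ground state, hence so does
    their anticommutator, the scalar <v, w>; as Phi is nonzero, this scalar is zero. *)
Lemma ground_state_orth (h h' : 'M[C]_(M + M)) c c' (v w : 'cV[C]_(M + M))
    (a b e e' : C) (Phi : 'cV[C]_F) :
  is_bdg_matrix h -> is_bdg_matrix h' -> Phi != 0 ->
  is_min_eigenvalue (bdg_op h c) e -> bdg_op h c *m Phi = e *: Phi ->
  is_min_eigenvalue (bdg_op h' c') e' -> bdg_op h' c' *m Phi = e' *: Phi ->
  h *m v = a *: v -> h' *m w = b *: w -> 0 < a -> b < 0 -> v^t* *m w = 0.
Proof.
move=> hB hB' Phi0 hm hP hm' hP' hv hw a0 b0.
have vP := quasi_op_ground_state hB a0 hv hm hP.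
have wP : (quasi_op w)^t* *m Phi = 0.
  (* By particle-hole conjugation the adjoint belongs to the positive eigenvalue - b. *)
  have nb0 : 0 < - b by rewrite oppr_gt0.
  rewrite quasi_op_adj.
  exact: (quasi_op_ground_state hB' nb0 (bar_conj_eigen hB' (ltr0_real b0) hw) hm' hP').
have := congr1 (fun X => X *m Phi) (quasi_op_anticomm v w).
rewrite mulmxDl -!mulmxA vP wP !mulmx0 addr0 mul_scalar_mx => /esym/eqP.
rewrite scaler_eq0 (negbTE Phi0) orbF => /eqP h0.
by apply/matrixP=> i j; rewrite !ord1 h0 mxE.
Qed.

Lemma frustration_free_parts (I : finType) (h : I -> 'M[C]_(M + M)) (c : I -> R) :
  (forall i, is_bdg_matrix (h i)) ->
  frustration_free (fun i => bdg_op (h i) (c i)) ->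
  forall i j, pos_part (h i) *m neg_part (h j) = 0.
Proof.
move=> hB [Phi [Phi0 gs]] i j.
apply: pos_neg_part_mul0 => [||v w a b]; [by case: (hB i) | by case: (hB j)|].
have [e [hm hP]] := gs i; have [e' [hm' hP']] := gs j.
exact: ground_state_orth (hB i) (hB j) Phi0 hm hP hm' hP'.
Qed.

End Fock.

(** * The periodic lattice *)

Section CenteredLift.
Variable L : nat.
Hypothesis L1 : (1 < L)%N.

(* The representative of a in [-L/2, L/2). *)
Definition clift (a : 'Z_L) : int :=
  if (2 * a < L)%N then (a : nat)%:Z else (a : nat)%:Z - L%:Z.

Lemma clift_ltL (a : 'Z_L) : (a < L)%N.
Proof. by have := ltn_ord a; rewrite [X in (_ < X)%N]Zp_cast. Qed.

Lemma intZp_eq0 (m : int) : m%:~R = 0 :> 'Z_L -> (`|m| < L)%N -> m = 0.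
Proof.
have H n : (n%:R : 'Z_L) = 0 -> (n < L)%N -> n = 0%N.
  by move=> /(congr1 (@nat_of_ord _)); rewrite val_Zp_nat //= => h /modn_small E; rewrite -E.
case: m => n h lt; first by rewrite (H n).
by move: h; rewrite NegzE mulrNz => /eqP; rewrite oppr_eq0 => /eqP h; rewrite (H n.+1).
Qed.

Lemma cliftK (a : 'Z_L) : (clift a)%:~R = a.
Proof.
have E : ((a : nat)%:R : 'Z_L) = a.
  by apply: val_inj; rewrite /= val_Zp_nat // modn_small // clift_ltL.
have L0 : (L%:R : 'Z_L) = 0 by apply: val_inj; rewrite /= val_Zp_nat // modnn.
rewrite /clift; case: ifP => _; first exact: E.
by rewrite rmorphB /= -!pmulrn E L0 subr0.
Qed.

Lemma clift_int (m : int) : (2 * `|m| < L)%N -> clift (m%:~R) = m.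
Proof.
move=> hm; set a : 'Z_L := m%:~R.
have E : (clift a - m)%:~R = 0 :> 'Z_L by rewrite rmorphB /= cliftK subrr.
apply/eqP; rewrite -subr_eq0; apply/eqP/(intZp_eq0 E).
rewrite /clift; have := clift_ltL a; case: ifP; lia.
Qed.

Lemma clift_le r (a : 'Z_L) : (2 * r < L)%N ->
  (minn a (L - a) <= r)%N -> (`|clift a| <= r)%N.
Proof. by rewrite /clift; have := clift_ltL a; case: ifP; lia. Qed.

(** The difference of the lifts has absolute value at most 2 r < L / 2, so it is itself the centred
    representative. *)
Lemma cliftB r (a b : 'Z_L) : (4 * r < L)%N -> (`|clift a| <= r)%N ->
  (`|clift b| <= r)%N -> clift (a - b) = clift a - clift b.
Proof.
move=> hL ha hb; rewrite -{1}(cliftK a) -{1}(cliftK b) -rmorphB /=.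
by apply: clift_int; lia.
Qed.

End CenteredLift.

(** * Unit complex phases *)

Section Phase.
Variable R : realType.

Lemma phaseD (a b : R) : phase (a + b) = phase a * phase b.
Proof.
rewrite /phase cosD sinD; congr Complex.
by rewrite addrC [sin _ * _]mulrC [cos b * _]mulrC.
Qed.

Lemma phase_conj (a : R) : (phase a)^* = phase (- a).
Proof. by rewrite /phase cosN sinN. Qed.

Lemma phase_norm (a : R) : `|phase a| = 1.
Proof. by rewrite normc_def /= cos2Dsin2 sqrtr1. Qed.

End Phase.

(** * Nambu indices by cells, and lattice shifts *)

Section Lattice.
Variables (R : realType) (d L N : nat).
Local Notation C := R[i].
Local Notation M := (num_modes d L N).
Local Notation cell := (cell d L).
Local Notation ni := (@nambu_index d L N).

Definition nambu_cell (a : 'I_(M + M)) : cell * 'I_(N + N) :=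
  match fintype.split a with
  | inl m => ((enum_val m).1, lshift N (enum_val m).2)
  | inr m => ((enum_val m).1, rshift N (enum_val m).2)
  end.

Lemma nambu_index_lshift x tau : ni x (lshift N tau) = lshift M (mode x tau).
Proof. by rewrite /nambu_index -[lshift N tau]/(unsplit (inl tau)) unsplitK. Qed.

Lemma nambu_index_rshift x tau : ni x (rshift N tau) = rshift M (mode x tau).
Proof. by rewrite /nambu_index -[rshift N tau]/(unsplit (inr tau)) unsplitK. Qed.

Lemma nambu_cellK a : ni (nambu_cell a).1 (nambu_cell a).2 = a.
Proof.
rewrite -[RHS]splitK /nambu_cell; case: (fintype.split a) => m /=.
  by rewrite nambu_index_lshift /mode -surjective_pairing enum_valK.
by rewrite nambu_index_rshift /mode -surjective_pairing enum_valK.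
Qed.

Lemma nambu_indexK x s : nambu_cell (ni x s) = (x, s).
Proof.
case: (split_ordP s) => tau ->; rewrite ?nambu_index_lshift ?nambu_index_rshift /nambu_cell.
  by rewrite -[lshift M _]/(unsplit (inl _)) unsplitK /mode enum_rankK.
by rewrite -[rshift M _]/(unsplit (inr _)) unsplitK /mode enum_rankK.
Qed.

Lemma big_nambu (V : nmodType) (F : 'I_(M + M) -> V) :
  \sum_a F a = \sum_x \sum_s F (ni x s).
Proof.
rewrite pair_bigA /= (reindex (fun p : cell * 'I_(N + N) => ni p.1 p.2)) //.
exists nambu_cell => [[x s] _|a _]; [exact: nambu_indexK | exact: nambu_cellK].
Qed.

Definition sub_cell (x y : cell) : cell := [ffun i => x i - y i].

Lemma add_cellK (a : cell) : cancel (fun x => add_cell x a) (fun x => sub_cell x a).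
Proof. by move=> x; apply/ffunP=> i; rewrite !ffunE addrK. Qed.

Lemma sub_cellK (a : cell) : cancel (fun x => sub_cell x a) (fun x => add_cell x a).
Proof. by move=> x; apply/ffunP=> i; rewrite !ffunE subrK. Qed.

Definition nambu_shift (a : cell) (z : 'I_(M + M)) : 'I_(M + M) :=
  ni (add_cell (nambu_cell z).1 a) (nambu_cell z).2.

Lemma nambu_shift_bij a : bijective (nambu_shift a).
Proof.
exists (fun z => ni (sub_cell (nambu_cell z).1 a) (nambu_cell z).2) => z.
  by rewrite /nambu_shift nambu_indexK /= add_cellK nambu_cellK.
by rewrite /nambu_shift nambu_indexK /= sub_cellK nambu_cellK.
Qed.

Definition shift_invariant (X : 'M[C]_(M + M)) :=
  forall a x y, X (nambu_shift a x) (nambu_shift a y) = X x y.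

Lemma shift_invariantE X a x y s s' : shift_invariant X ->
  X (ni (add_cell x a) s) (ni (add_cell y a) s') = X (ni x s) (ni y s').
Proof. by move=> /(_ a (ni x s) (ni y s')); rewrite /nambu_shift !nambu_indexK. Qed.

Lemma nambu_translation a T : is_translation a T -> forall z,
  T *m nambu R z *m T^t* = nambu R (nambu_shift a z).
Proof.
move=> [_ hT] z; rewrite -(nambu_cellK z) /nambu_shift nambu_indexK /=.
case: (split_ordP (nambu_cell z).2) => tau ->.
  by rewrite !nambu_index_lshift !nambu_lshift hT.
rewrite !nambu_index_rshift !nambu_rshift -hT !adjmxM trmxCK.
by rewrite mulmxA.
Qed.

(** Conjugation by T turns the commutator of psi_z with the Hamiltonian into that of the shifted
    operator, and a commutator determines its row of h because the Nambu operators are linearly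
    independent. *)
Lemma translation_invariant_bdg (h : 'M[C]_(M + M)) c : is_bdg_matrix h ->
  translation_invariant (bdg_op h c) -> shift_invariant h.
Proof.
move=> hB hT a z y; have [T [Ta TH]] := hT a.
have TT : T^t* *m T = 1%:M by apply: unitary_adjK; case: Ta.
have conjM (A B : 'M[C]_(fock_dim M)) :
    T *m (A *m B) *m T^t* = (T *m A *m T^t*) *m (T *m B *m T^t*).
  by rewrite !mulmxA -[_ *m T^t* *m T]mulmxA TT mulmx1.
have E := congr1 (fun X => T *m X *m T^t*) (comm_bdg_op c z hB).
rewrite /= mulmxBr mulmxBl !conjM TH (nambu_translation Ta) comm_bdg_op // in E.
have n2 : (2 : C) != 0 by rewrite pnatr_eq0.
move: E; rewrite -scalemxAr -scalemxAl => /(scalerI n2) E.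
move: E; rewrite (reindex (nambu_shift a)); last exact/onW_bij/nambu_shift_bij.
rewrite mulmx_sumr mulmx_suml => /eqP; rewrite -subr_eq0 -sumrB => /eqP E.
apply/eqP; rewrite -subr_eq0; apply/eqP.
have [g gK Kg] := nambu_shift_bij a.
(* The coefficients of the difference of the two expansions, [g] being the inverse shift. *)
pose f w := h (nambu_shift a z) w - h z (g w).
have := @nambu_free _ _ f _ (nambu_shift a y); rewrite /f gK; apply.
rewrite (reindex (nambu_shift a)); last exact/onW_bij/nambu_shift_bij.
rewrite -[RHS]E; apply: eq_bigr => w _; rewrite gK scalerBl.
by rewrite -scalemxAr -scalemxAl (nambu_translation Ta).
Qed.

(** Shifting both parts gives another decomposition of the same matrix into semidefinite parts with
    product zero, and such a decomposition is unique. *)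
Lemma shift_invariant_parts (P Q : 'M[C]_(M + M)) : psd P -> psd Q -> P *m Q = 0 ->
  shift_invariant (P - Q) -> shift_invariant P /\ shift_invariant Q.
Proof.
move=> pP pQ PQ inv.
suff H a : P = mxsub (nambu_shift a) (nambu_shift a) P /\
           Q = mxsub (nambu_shift a) (nambu_shift a) Q.
  by split=> a x y; have [EP EQ] := H a; [rewrite {2}EP mxE | rewrite {2}EQ mxE].
apply: psd_decomposition_uniq => //; try exact: psd_mxsub.
  rewrite mxsub_mulmx ?PQ; last exact: nambu_shift_bij.
  by apply/matrixP=> i j; rewrite !mxE.
apply/matrixP=> i j; have := inv a i j; rewrite !mxE => <-.
by [].
Qed.

End Lattice.

(** * Bloch matrices *)

Section Bloch.
Variables (R : realType) (d L N r : nat).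
Hypothesis L1 : (1 < L)%N.
Hypothesis L4 : (4 * r < L)%N.
Local Notation C := R[i].
Local Notation M := (num_modes d L N).
Local Notation cell := (cell d L).
Local Notation ni := (@nambu_index d L N).
Local Notation "x -c y" := (@sub_cell d L x y) (at level 50).

(** Columns of h outside the box vanish, hence so do those of its positive part; Hermiticity carries
    this over to the rows. *)
Lemma has_range_pos_part x (h : 'M[C]_(M + M)) : h \is hermsymmx ->
  has_range r x h -> has_range r x (pos_part h).
Proof.
move=> hh hr.
have H z s' : ~~ (periodic_dist z x <= r)%N -> forall w, pos_part h w (ni z s') = 0.
  move=> zx w; apply: pos_part_col0 => // w'; rewrite -[w']nambu_cellK.
  by apply: hr; rewrite (negbTE zx) andbF.
move=> y z s s'; rewrite negb_and => /orP[|] hx; last exact: H.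
by rewrite -(psd_herm (pos_part_psd h)) adjmxE H // conjC0.
Qed.

Lemma has_range_neg_part x (h : 'M[C]_(M + M)) : h \is hermsymmx ->
  has_range r x h -> has_range r x (neg_part h).
Proof.
move=> hh hr.
have H z s' : ~~ (periodic_dist z x <= r)%N -> forall w, neg_part h w (ni z s') = 0.
  move=> zx w; apply: neg_part_col0 => // w'; rewrite -[w']nambu_cellK.
  by apply: hr; rewrite (negbTE zx) andbF.
move=> y z s s'; rewrite negb_and => /orP[|] hx; last exact: H.
by rewrite -(psd_herm (neg_part_psd h)) adjmxE H // conjC0.
Qed.

Lemma lift_bound x y i : (periodic_dist y x <= r)%N -> (`|clift ((y -c x) i)| <= r)%N.
Proof.
move=> /bigmax_leqP/(_ i isT) h; rewrite ffunE; apply: clift_le => //; lia.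
Qed.

Lemma sub_cell_lift x y z i : (periodic_dist y x <= r)%N -> (periodic_dist z x <= r)%N ->
  clift ((y -c z) i) = clift ((y -c x) i) - clift ((z -c x) i).
Proof.
move=> /(lift_bound i) hy /(lift_bound i) hz; rewrite -(cliftB L1 L4) //; congr clift.
by rewrite !ffunE opprB addrA subrK.
Qed.

Lemma sub_cell_lift2 x x' z i : (periodic_dist z x <= r)%N -> (periodic_dist z x' <= r)%N ->
  clift ((x' -c x) i) = clift ((z -c x) i) - clift ((z -c x') i).
Proof.
move=> /lift_bound hx /lift_bound hx'; rewrite -(cliftB L1 L4) //; congr clift.
by rewrite !ffunE opprB [RHS]addrC addrA subrK.
Qed.

(** For general k this is not a character of the torus: it is multiplicative only where the centred
    lifts add up, as they do within a common box. *)
Definition cell_phase (k : 'rV[R]_d) (x : cell) : C :=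
  phase (- \sum_i k 0 i * (clift (x i))%:~R).

Variable X : cell -> 'M[C]_(M + M).
Hypothesis X_range : forall x, has_range r x (X x).

Lemma local_sum_neq0 y z s s' : (\sum_x X x) (ni y s) (ni z s') != 0 ->
  exists x, (periodic_dist y x <= r)%N && (periodic_dist z x <= r)%N.
Proof.
rewrite summxE => h; apply/existsP; apply: contraR h; rewrite negb_exists => /forallP h.
by apply/eqP; apply: big1 => x _; apply: X_range.
Qed.

Lemma displacement_bound (u : {ffun 'I_d -> 'I_(4 * r).+1}) i :
  (`|displacement u i| <= 2 * r)%N.
Proof. by rewrite /displacement; have := ltn_ord (u i); lia. Qed.

Lemma cell_of_displacement_lift (u : {ffun 'I_d -> 'I_(4 * r).+1}) i :
  clift (cell_of_displacement L u i) = displacement u i.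
Proof.
by rewrite ffunE clift_int //; have := displacement_bound u i; lia.
Qed.

(** Since 4 r < L, displacements correspond to cells whose centred lifts are at most 2 r in absolute
    value; all other cells contribute zero by locality. *)
Lemma bloch_bdg_lift k s s' : bloch_bdg r (\sum_x X x) k s s' =
  \sum_y cell_phase k y * (\sum_x X x) (ni y s) (ni [ffun=> 0] s').
Proof.
rewrite mxE; pose P (y : cell) := [forall i, (`|clift (y i)| <= 2 * r)%N].
rewrite [RHS](bigID P) /= [X in _ = _ + X]big1 ?addr0; last first.
  move=> y; apply: contraNeq; rewrite mulf_eq0 negb_or => /andP[_ /local_sum_neq0[x]].
  move=> /andP[yx zx]; apply/forallP=> i.
  have -> : y i = (y -c [ffun=> 0]) i by rewrite !ffunE subr0.
  rewrite (sub_cell_lift _ yx zx).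
  by have := lift_bound i yx; have := lift_bound i zx; lia.
(* Adding 2 r encodes a displacement as an ordinal; under [P] the value stays below 4 r + 1, where
   [inord] is exact. *)
pose inv (y : cell) : {ffun 'I_d -> 'I_(4 * r).+1} :=
  [ffun i => inord (absz (clift (y i) + (2 * r)%:Z))].
rewrite [RHS](reindex_onto (@cell_of_displacement d L r) inv) /=; last first.
  move=> y /forallP hy; apply/ffunP=> i; rewrite ffunE /displacement ffunE inordK.
    have -> : (absz (clift (y i) + (2 * r)%:Z))%:Z - (2 * r)%:Z = clift (y i).
      by move: (hy i); move: (clift (y i)) => m; lia.
    exact: cliftK.
  by move: (hy i); move: (clift (y i)) => m; lia.
apply: eq_big => [u|u _].
  symmetry; apply/andP; split.
    by apply/forallP=> i; rewrite cell_of_displacement_lift displacement_bound.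
  apply/eqP/ffunP=> i; rewrite ffunE cell_of_displacement_lift; apply: val_inj.
  by rewrite /= inordK; have := ltn_ord (u i); rewrite /displacement; lia.
congr (phase (- _) * _); apply: eq_bigr => i _.
by rewrite cell_of_displacement_lift.
Qed.

Lemma bloch_bdg_base k z s s' : shift_invariant (\sum_x X x) ->
  bloch_bdg r (\sum_x X x) k s s' =
  \sum_y cell_phase k (y -c z) * (\sum_x X x) (ni y s) (ni z s').
Proof.
move=> inv; rewrite bloch_bdg_lift [LHS](reindex (fun y => y -c z)); last first.
  by apply: onW_bij; exists (fun y => add_cell y z); [apply: sub_cellK | apply: add_cellK].
apply: eq_bigr => y _; congr (_ * _).
rewrite -(shift_invariantE z _ _ _ _ inv) sub_cellK; congr (_ _ (ni _ _)).
by apply/ffunP=> i; rewrite !ffunE add0r.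
Qed.

Lemma cell_phase_sub k x y z : (periodic_dist y x <= r)%N -> (periodic_dist z x <= r)%N ->
  cell_phase k (y -c z) = cell_phase k (y -c x) * (cell_phase k (z -c x))^*.
Proof.
move=> yx zx; rewrite /cell_phase phase_conj -phaseD; congr phase.
rewrite -opprD -sumrB; congr (- _); apply: eq_bigr => i _.
by rewrite (sub_cell_lift i yx zx) rmorphB mulrBr.
Qed.

(** Summing over the base cell turns the form into a sum over x of the forms of X_x at plane waves
    centred at x, because the phases factorize within each box. *)
Lemma bloch_bdg_psd k v : shift_invariant (\sum_x X x) -> (forall x, psd (X x)) ->
  0 <= qform (bloch_bdg r (\sum_x X x) k) v.
Proof.
move=> inv Xp.
(* The summand is constant in z, so the sum is the form times the positive number of cells. *)
suff : 0 <= \sum_(z : cell) qform (bloch_bdg r (\sum_x X x) k) v.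
  rewrite sumr_const pmulrn_lge0 //.
  by apply/card_gt0P; exists [ffun=> 0].
(* The plane wave e^(i k.(y - x)) v_s, in centred coordinates around x. *)
pose w (x : cell) : 'cV[C]_(M + M) := \col_a
  ((cell_phase k ((nambu_cell a).1 -c x))^* * v (nambu_cell a).2 0).
suff -> : \sum_(z : cell) qform (bloch_bdg r (\sum_x X x) k) v = \sum_x qform (X x) (w x).
  by apply: sumr_ge0 => x _; exact: psd_ge0.
have E z : qform (bloch_bdg r (\sum_x X x) k) v =
  \sum_x \sum_s \sum_s' \sum_y
     (v s 0)^* * (cell_phase k (y -c z) * X x (ni y s) (ni z s')) * v s' 0.
  rewrite qformE [RHS]exchange_big; apply: eq_bigr => s _ /=.
  rewrite [RHS]exchange_big; apply: eq_bigr => s' _ /=.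
  rewrite (bloch_bdg_base k z) // mulr_sumr mulr_suml [RHS]exchange_big; apply: eq_bigr => y _ /=.
  by rewrite summxE mulr_sumr mulr_sumr mulr_suml.
rewrite (eq_bigr _ (fun z _ => E z)).
rewrite exchange_big; apply: eq_bigr => x _ /=.
rewrite qformE big_nambu; under [RHS]eq_bigr => y _.
  under eq_bigr => s _ do rewrite big_nambu.
  rewrite exchange_big.
  over.
rewrite [RHS]exchange_big; apply: eq_bigr => z _ /=.
rewrite [RHS]exchange_big; apply: eq_bigr => s _ /=.
rewrite [RHS]exchange_big; apply: eq_bigr => s' _ /=; apply: eq_bigr => y _ /=.
rewrite !mxE !nambu_indexK /=.
have [near|far] := boolP ((periodic_dist y x <= r)%N && (periodic_dist z x <= r)%N).
  case/andP: near => yx zx; rewrite (cell_phase_sub k yx zx) rmorphM /= conjCK.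
  ring.
by rewrite (X_range _ _ far) !(mulr0, mul0r).
Qed.

End Bloch.

(** * Products of Bloch matrices at continuous k *)

Section BlochProduct.
Variables (R : realType) (d L N r : nat).
Hypothesis L1 : (1 < L)%N.
Hypothesis L4 : (4 * r < L)%N.
Local Notation C := R[i].
Local Notation M := (num_modes d L N).
Local Notation cell := (cell d L).
Local Notation ni := (@nambu_index d L N).
Local Notation "x -c y" := (@sub_cell d L x y) (at level 50).
Variables X Y : cell -> 'M[C]_(M + M).
Hypothesis X_range : forall x, has_range r x (X x).
Hypothesis Y_range : forall x, has_range r x (Y x).

(* For y, z near x and z, w near x', the phase of y - z plus that of z - w does not
   depend on z, so the sum over z is an entry of X x *m Y x'. *)
Lemma cell_phase_path (k : 'rV[R]_d) x x' y z w :
  (periodic_dist y x <= r)%N -> (periodic_dist z x <= r)%N ->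
  (periodic_dist z x' <= r)%N -> (periodic_dist w x' <= r)%N ->
  cell_phase k (y -c z) * cell_phase k (z -c w) =
  cell_phase k (y -c x) * (cell_phase k (x' -c x))^* * (cell_phase k (w -c x'))^*.
Proof.
move=> yx zx zx' wx'; rewrite /cell_phase !phase_conj -!phaseD; congr phase.
rewrite -!opprD; congr (- _); rewrite -!sumrN -!big_split /=; apply: eq_bigr => i _.
rewrite (sub_cell_lift L1 L4 i yx zx) (sub_cell_lift L1 L4 i zx' wx')
  (sub_cell_lift2 L1 L4 i zx zx').
by rewrite !rmorphB /=; ring.
Qed.

(** Expanded over local terms, the sum over the intermediate index carries a constant phase and
    becomes an entry of X_x Y_x', which is zero. *)
Lemma bloch_bdg_mul0 (k : 'rV[R]_d) : shift_invariant (\sum_x X x) ->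
  (forall x x', X x *m Y x' = 0) ->
  bloch_bdg r (\sum_x X x) k *m bloch_bdg r (\sum_x Y x) k = 0.
Proof.
move=> inv XY; apply/matrixP=> s t; rewrite [RHS]mxE mxE.
pose o : cell := [ffun=> 0].
have E s' : bloch_bdg r (\sum_x X x) k s s' * bloch_bdg r (\sum_x Y x) k s' t =
   \sum_y \sum_x \sum_x' \sum_z
     (cell_phase k (y -c z) * cell_phase k (z -c o)) *
     (X x (ni y s) (ni z s') * Y x' (ni z s') (ni o t)).
  rewrite (bloch_bdg_lift L1 L4 Y_range) mulr_sumr.
  under eq_bigr => z _ do rewrite (bloch_bdg_base L1 L4 X_range k z) // mulr_suml.
  rewrite exchange_big; apply: eq_bigr => y _ /=.
  under [RHS]eq_bigr => x _ do rewrite exchange_big.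
  rewrite [RHS]exchange_big; apply: eq_bigr => z _ /=.
  rewrite !summxE mulr_sumr mulr_suml; apply: eq_bigr => x _ /=.
  rewrite !mulr_sumr; apply: eq_bigr => x' _ /=.
  have -> : z -c o = z by apply/ffunP=> i; rewrite !ffunE subr0.
  by ring.
rewrite (eq_bigr _ (fun s' _ => E s')) exchange_big big1 // => y _ /=.
rewrite exchange_big big1 // => x _ /=; rewrite exchange_big big1 // => x' _ /=.
(* The common phase, free of the intermediate cell. *)
pose c := cell_phase k (y -c x) * (cell_phase k (x' -c x))^* * (cell_phase k (o -c x'))^*.
transitivity (c * (X x *m Y x') (ni y s) (ni o t)); last by rewrite XY mxE mulr0.
rewrite mxE big_nambu [in RHS]exchange_big mulr_sumr; apply: eq_bigr => s' _ /=.
rewrite mulr_sumr; apply: eq_bigr => z _.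
have [/andP[yx zx]|far] := boolP ((periodic_dist y x <= r)%N && (periodic_dist z x <= r)%N);
  last by rewrite (X_range _ _ far) !(mul0r, mulr0).
have [/andP[zx' ox']|far] := boolP ((periodic_dist z x' <= r)%N && (periodic_dist o x' <= r)%N);
  last by rewrite (Y_range _ _ far) !mulr0.
by rewrite (cell_phase_path k yx zx zx' ox').
Qed.

End BlochProduct.

(** * Quadratic bounds *)

Section SecondDifference.
Variable R : realType.
Local Notation C := R[i].

Lemma normr_sin_le (x : R) : `|sin x| <= `|x|.
Proof.
wlog x0 : x / 0 <= x => [H|].
  have [/H //|x0] := leP 0 x.
  by rewrite -normrN -sinN -[leRHS]normrN H // oppr_ge0 ltW.
have [|c _] := MVT_segment x0 (fun y _ => is_derive_sin y).
  exact/continuous_subspaceT/continuous_sin.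
by rewrite sin0 !subr0 => ->; rewrite normrM ler_piMl // cos_max.
Qed.

(** The left side is 4 sin^2 (x / 2), and |sin y| <= |y|. *)
Lemma cos_lower_bound (x : R) : 2 - 2 * cos x <= x ^+ 2.
Proof.
have -> : x = (x / 2) *+ 2 by rewrite -mulr_natr divfK // pnatr_eq0.
rewrite cos_mulr2n cos2sin2.
set y := x / 2; have -> : 2 - 2 * ((1 - sin y ^+ 2) *+ 2 - 1) = 4 * sin y ^+ 2 by ring.
have -> : (y *+ 2) ^+ 2 = 4 * y ^+ 2 by ring.
by rewrite ler_pM2l ?ltr0n // -real_normK ?num_real // -[leRHS]real_normK ?num_real //
  lerXn2r ?nnegrE // normr_sin_le.
Qed.

(** The second difference factors as [phase a] times 2 cos b - 2. *)
Lemma phase_second_diff (a b : R) :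
  `|phase (a + b) + phase (a - b) - 2 * phase a| <= (b ^+ 2)%:C%C.
Proof.
have -> : phase (a + b) + phase (a - b) - 2 * phase a = phase a * (2 * cos b - 2)%:C%C.
  rewrite !phaseD {2 4}/phase cosN sinN.
  have -> : (2 * cos b - 2)%:C%C = Complex (cos b) (sin b) + Complex (cos b) (- sin b) - 2.
    by rewrite /phase; apply/eqP; rewrite eq_complex /= subrr; apply/andP; split;
      apply/eqP; ring.
  by ring.
rewrite normrM phase_norm mul1r -normrN -rmorphN opprB ger0_norm; last first.
  by rewrite ler0c subr_ge0 ler_piMr // cos_le1.
by rewrite lecR cos_lower_bound.
Qed.

(** Cauchy-Schwarz, by summing 2 x y <= x^2 + y^2 over pairs of indices. *)
Lemma sqr_dot_le d (a b : 'I_d -> R) :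
  (\sum_i a i * b i) ^+ 2 <= (\sum_i b i ^+ 2) * \sum_i a i ^+ 2.
Proof.
rewrite -(ler_pM2l (ltr0n _ 2 : 0 < 2)).
have -> : 2 * (\sum_i a i * b i) ^+ 2 = \sum_i \sum_j 2 * ((a i * b j) * (a j * b i)).
  rewrite expr2 mulr_suml mulr_sumr; apply: eq_bigr => i _; rewrite !mulr_sumr.
  by apply: eq_bigr => j _; ring.
have -> : 2 * ((\sum_i b i ^+ 2) * \sum_i a i ^+ 2) =
    \sum_i \sum_j ((a i * b j) ^+ 2 + (a j * b i) ^+ 2).
  under [RHS]eq_bigr => i _ do rewrite big_split.
  rewrite big_split /= [X in _ + X]exchange_big -mulr2n -[LHS]/(_ * _) mulr_natl mulrC.
  congr (_ *+ 2); rewrite mulr_suml; apply: eq_bigr => i _; rewrite mulr_sumr.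
  by apply: eq_bigr => j _; rewrite exprMn.
apply: ler_sum => i _; apply: ler_sum => j _.
rewrite -subr_ge0; set x := a i * b j; set y := a j * b i.
have -> : x ^+ 2 + y ^+ 2 - 2 * (x * y) = (x - y) ^+ 2 by ring.
exact: sqr_ge0.
Qed.

Variables (d L N r : nat).
Local Notation M := (num_modes d L N).
Implicit Type X : 'M[C]_(M + M).

Definition hopping X (u : {ffun 'I_d -> 'I_(4 * r).+1}) : 'M[C]_(N + N) :=
  \matrix_(s, s') X (nambu_index (cell_of_displacement L u) s)
                    (nambu_index [ffun=> 0] s').

Lemma bloch_bdgE X k : bloch_bdg r X k =
  \sum_u phase (- \sum_i k 0 i * (displacement u i)%:~R) *: hopping X u.
Proof.
apply/matrixP=> s s'; rewrite mxE summxE; apply: eq_bigr => u _.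
by rewrite !mxE.
Qed.

Lemma bloch_bdgB X Y k : bloch_bdg r (X - Y) k = bloch_bdg r X k - bloch_bdg r Y k.
Proof.
rewrite !bloch_bdgE -sumrB; apply: eq_bigr => u _; rewrite -scalerBr; congr (_ *: _).
by apply/matrixP=> s s'; rewrite !mxE.
Qed.

(** The second difference multiplies the hopping of u by a factor of modulus at most (q.u)^2 <=
    |u|^2 |q|^2, so K is the sum of |u|^2 times the entrywise 1-norm of the hopping. *)
Lemma bloch_second_diff X : exists2 K : R, 0 <= K & forall (k q : 'rV[R]_d) v,
  `|qform (bloch_bdg r X (k + q)) v + qform (bloch_bdg r X (k - q)) v
     - 2 * qform (bloch_bdg r X k) v| <= (K * sqr_norm q)%:C%C * sqnorm v.
Proof.
pose t u := \sum_s \sum_s' `|hopping X u s s'|.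
have t0 u : 0 <= t u by apply: sumr_ge0 => s _; apply: sumr_ge0.
pose w (u : {ffun 'I_d -> 'I_(4 * r).+1}) : R := \sum_i (displacement u i)%:~R ^+ 2.
have w0 u : 0 <= w u by apply: sumr_ge0 => i _; exact: sqr_ge0.
(* The norms are real but typed as complex; the real part makes K an element of R. *)
have tE u : (complex.Re (t u))%:C%C = t u by rewrite RRe_real // ger0_real.
have tr0 u : 0 <= complex.Re (t u) by rewrite -ler0c tE.
exists (\sum_u w u * complex.Re (t u)) => [|k q v].
  by apply: sumr_ge0 => u _; rewrite mulr_ge0.
pose dot (p : 'rV[R]_d) (u : {ffun 'I_d -> 'I_(4 * r).+1}) : R :=
  \sum_i p 0 i * (displacement u i)%:~R.
have E p : qform (bloch_bdg r X p) v = \sum_u phase (- dot p u) * qform (hopping X u) v.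
  by rewrite bloch_bdgE qform_sum; apply: eq_bigr => u _; rewrite qformZ.
rewrite !E mulr_sumr -big_split -sumrB /=; apply: le_trans (ler_norm_sum _ _ _) _.
rewrite mulr_suml rmorph_sum mulr_suml; apply: ler_sum => u _.
rewrite mulrA -mulrDl -mulrBl normrM.
have -> : dot (k + q) u = dot k u + dot q u.
  by rewrite /dot -big_split; apply: eq_bigr => i _; rewrite mxE mulrDl.
have -> : dot (k - q) u = dot k u - dot q u.
  by rewrite /dot -sumrB; apply: eq_bigr => i _; rewrite !mxE mulrBl.
rewrite opprB opprD [dot q u - _]addrC [phase _ + phase _]addrC.
have h1 := phase_second_diff (- dot k u) (dot q u).
have h2 : ((dot q u) ^+ 2)%:C%C <= (w u * sqr_norm q)%:C%C by rewrite lecR sqr_dot_le.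
rewrite mulrAC rmorphM /= tE -mulrA.
apply: ler_pM => //; last exact: qform_bound.
exact: le_trans h1 h2.
Qed.

(* <v, B_k v> is nonnegative in k and vanishes at k0, so it is at most the second
   difference <v, (B_k + B_(2 k0 - k) - 2 B_k0) v>. *)
Lemma bloch_kernel_bound X (k0 : 'rV[R]_d) :
  (forall (k : 'rV[R]_d) v, 0 <= qform (bloch_bdg r X k) v) ->
  exists2 K : R, 0 <= K & forall (k : 'rV[R]_d) v, bloch_bdg r X k0 *m v = 0 ->
    qform (bloch_bdg r X k) v <= (K * sqr_norm (k - k0))%:C%C * sqnorm v.
Proof.
move=> X0; have [K K0 KE] := bloch_second_diff X; exists K => // k v kv.
have := KE k0 (k - k0) v.
have -> : qform (bloch_bdg r X k0) v = 0 by rewrite /qform -mulmxA kv mulmx0 mxE.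
rewrite mulr0 subr0 [k0 + _]addrC subrK ger0_norm ?addr_ge0 //.
by apply: le_trans; rewrite lerDl.
Qed.

End SecondDifference.

(** * Min-max comparison and the quadratic bound *)

Lemma card_ltn_gtn m (n : 'I_m) :
  (#|[set j : 'I_m | (j < n)%N]| + #|[set j : 'I_m | (n < j)%N]| < m)%N.
Proof.
rewrite -cardsUI.
have -> : [set j : 'I_m | (j < n)%N] :&: [set j : 'I_m | (n < j)%N] = finset.set0.
  by apply/setP=> j; rewrite !inE; case: ltngtP.
have -> : [set j : 'I_m | (j < n)%N] :|: [set j : 'I_m | (n < j)%N] = [set~ n].
  by apply/setP=> j; rewrite !inE -neq_ltn.
by rewrite cards0 addn0 cardsC1 card_ord; case: m n => [[]|].
Qed.

Theorem mainTheorem5 (R : realType) (d L N r : nat)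
    (h : cell d L -> 'M[R[i]]_(num_modes d L N + num_modes d L N))
    (C : cell d L -> R)
    (hL : (2 * (2 * r + 1) < L)%N)
    (h_bdg : forall x : cell d L, is_bdg_matrix (h x))
    (h_range : forall x : cell d L, has_range r x (h x))
    (h_translation :
       translation_invariant (\sum_(x : cell d L) bdg_op (h x) (C x)))
    (h_ff : frustration_free (fun x : cell d L => bdg_op (h x) (C x)))
    (E : 'rV[R]_d -> 'I_(N + N) -> R)
    (hE : forall k : 'rV[R]_d,
       is_ordered_spectrum (bloch_bdg r (\sum_(x : cell d L) h x) k) (E k))
    (n : 'I_(N + N)) (k0 : 'rV[R]_d)
    (hn : E k0 n = 0) :
  (fun k : 'rV[R]_d => E k n) =O_ k0 (fun k : 'rV[R]_d => sqr_norm (k - k0)).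
Proof.
have L1 : (1 < L)%N by lia.
have L4 : (4 * r < L)%N by lia.
have hh x : h x \is hermsymmx by case: (h_bdg x).
pose P x := pos_part (h x); pose Q x := neg_part (h x).
have PQ : forall x y, P x *m Q y = 0 := frustration_free_parts h_bdg h_ff.
have Pr x : has_range r x (P x) := has_range_pos_part (hh x) (h_range x).
have Qr x : has_range r x (Q x) := has_range_neg_part (hh x) (h_range x).
have Pp x : psd (P x) := pos_part_psd (h x).
have Qp x : psd (Q x) := neg_part_psd (h x).
have hPQ : \sum_x h x = \sum_x P x - \sum_x Q x.
  by rewrite -sumrB; apply: eq_bigr => x _; exact: pos_neg_part.
have PQs : (\sum_x P x) *m (\sum_x Q x) = 0.
  rewrite mulmx_suml big1 // => x _; rewrite mulmx_sumr big1 // => y _; exact: PQ.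
(* The difference of the two sums is the matrix of the full Hamiltonian, which inherits shift
   invariance from Fock space. *)
have [Pi Qi] : shift_invariant (\sum_x P x) /\ shift_invariant (\sum_x Q x).
  apply: shift_invariant_parts => //; try exact: psd_sum.
  rewrite -hPQ; move: h_translation; rewrite bdg_op_sum.
  by apply: translation_invariant_bdg; exact: bdg_matrix_sum.
pose Pk := bloch_bdg r (\sum_x P x); pose Qk := bloch_bdg r (\sum_x Q x).
have Pk0 : forall k v, 0 <= qform (Pk k) v by move=> k v; exact: (bloch_bdg_psd L1 L4 Pr k v Pi Pp).
have Qk0 : forall k v, 0 <= qform (Qk k) v by move=> k v; exact: (bloch_bdg_psd L1 L4 Qr k v Qi Qp).
have PQk : Pk k0 *m Qk k0 = 0 := bloch_bdg_mul0 L1 L4 Pr Qr k0 Pi PQ.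
(* The adjoint of the previous identity, for the lower bound, where P and Q exchange roles. *)
have QPk : Qk k0 *m Pk k0 = 0.
  by rewrite -(psd_herm (psd_of_qform (Qk0 k0))) -(psd_herm (psd_of_qform (Pk0 k0)))
    -adjmxM PQk adjmx0.
have diag k : (exists2 U : 'M[R[i]]_(N + N), U \is unitarymx &
    Pk k - Qk k = U^t* *m diag_mx (\row_j (E k j)%:C%C) *m U).
  have [_] := hE k; rewrite hPQ bloch_bdgB; apply: hermitian_diag.
  exact: (hermsymmB (hermitian_of_qform (Pk0 k)) (hermitian_of_qform (Qk0 k))).
have diagN k : (exists2 U : 'M[R[i]]_(N + N), U \is unitarymx &
    Qk k - Pk k = U^t* *m diag_mx (\row_j (- E k j)%:C%C) *m U).
  have [U Uu UE] := diag k; exists U => //.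
  rewrite -opprB UE -mulNmx -mulmxN -linearN /=; congr (_ *m diag_mx _ *m _).
  by apply/rowP=> j; rewrite !mxE rmorphN.
have [KP KP0 KPE] := bloch_kernel_bound k0 Pk0.
have [KQ KQ0 KQE] := bloch_kernel_bound k0 Qk0.
have mono k (i j : 'I_(N + N)) : (i <= j)%N -> E k i <= E k j by case: (hE k) => m _; apply: m.
(* The test vector lies in the span of the levels j >= n at k and in that of the levels j <= n at
   k0; the latter have E_j(k0) <= 0, so P_k0 kills them. *)
have upper k : E k n <= KP * sqr_norm (k - k0).
  have [U Uu UE] := diag k; have [U0 U0u U0E] := diag k0.
  rewrite -lecR; apply: (eigenvalue_comparison Uu U0u UE U0E (Qk0 k)
    (psd_of_qform (Pk0 k0)) PQk (card_ltn_gtn n)) => [j|j|v]; last exact: KPE.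
    by rewrite inE -leqNgt => nj; rewrite mxE lecR mono.
  by rewrite inE -leqNgt => nj; rewrite mxE -(rmorph0 (real_complex R)) lecR -hn mono.
(* The levels of Q - P are - E_j, decreasing in j, so the two index sets swap. *)
have lower k : - E k n <= KQ * sqr_norm (k - k0).
  have [U Uu UE] := diagN k; have [U0 U0u U0E] := diagN k0.
  have := card_ltn_gtn n; rewrite addnC => card_lt.
  rewrite -lecR; apply: (eigenvalue_comparison Uu U0u UE U0E (Pk0 k)
    (psd_of_qform (Qk0 k0)) QPk card_lt) => [j|j|v]; last exact: KQE.
    by rewrite inE -leqNgt => nj; rewrite mxE lecR lerN2 mono.
  rewrite inE -leqNgt => nj.
  by rewrite mxE -(rmorph0 (real_complex R)) lecR oppr_le0 -hn mono.
have sq0 (v : 'rV[R]_d) : 0 <= sqr_norm v.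
  by apply: sumr_ge0 => i _; exact: sqr_ge0.
(* The added 1 makes the constant strictly positive even if both bounds are zero. *)
apply/eqO_exP; exists (KP + KQ + 1).
  by rewrite ltr_wpDl // addr_ge0.
apply: filterE => k; rewrite [X in _ <= _ * X]ger0_norm // !mulrDl.
have := upper k; have := lower k; have := sq0 (k - k0).
have : 0 <= KP * sqr_norm (k - k0) by rewrite mulr_ge0.
have : 0 <= KQ * sqr_norm (k - k0) by rewrite mulr_ge0.
rewrite ler_norml mul1r; lra.
Qed.
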